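(* Let $$\mathcal{G}=\{(\tau,s)\in\mathbb{R}^2:\ \tau+s>0,\ -\tau^2-s^2-\tau s+\tau+s+1>0\}.$$ (a) Suppose $q=1$, $p\ge1$, and write $B=B_1$, $y=y_1$. For any $\sigma_1\in(p-1,+\infty)$, $\sigma_2=0$ and $(\tau,s)\in\mathcal{G}$, the GS-ADMM iteration converges globally: $\lim_{k\to\infty}\sum_{i=1}^p\|A_i(x_i^k-x_i^{k+1})\|^2=0$, $\lim_{k\to\infty}\|\mathcal{A}\mathbf{x}^k+By^k-c\|=0$, and there is $\mathbf{w}^\infty\in\mathcal{M}^*$ with $\lim_{k\to\infty}\widetilde{\mathbf{w}}^k=\mathbf{w}^\infty$. (b) Suppose $p=1$, $q\ge1$, and write $A=A_1$, $x=x_1$. For any $\sigma_1=0$, $\sigma_2\in(q-1,+\infty)$ and $(\tau,s)\in\mathcal{G}$, the GS-ADMM iteration converges globally: $\lim_{k\to\infty}\sum_{j=1}^q\|B_j(y_j^k-y_j^{k+1})\|^2=0$, $\lim_{k\to\infty}\|Ax^k+\mathcal{B}\mathbf{y}^k-c\|=0$, and there is $\mathbf{w}^\infty\in\mathcal{M}^*$ with $\lim_{k\to\infty}\widetilde{\mathbf{w}}^k=\mathbf{w}^\infty$.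
   Context: Setting. $p,q\ge1$ are integers; $f_i:\mathbb{R}^{m_i}\to\mathbb{R}$ ($1\le i\le p$) and $g_j:\mathbb{R}^{d_j}\to\mathbb{R}$ ($1\le j\le q$) are closed proper convex functions; $A_i\in\mathbb{R}^{n\times m_i}$, $B_j\in\mathbb{R}^{n\times d_j}$ all have full column rank; $c\in\mathbb{R}^n$; $\mathcal{X}_i\subset\mathbb{R}^{m_i}$, $\mathcal{Y}_j\subset\mathbb{R}^{d_j}$ are closed convex sets. The problem is: minimize $\sum_i f_i(x_i)+\sum_j g_j(y_j)$ subject to $\sum_i A_ix_i+\sum_j B_jy_j=c$, $x_i\in\mathcal{X}_i$, $y_j\in\mathcal{Y}_j$; its solution set is assumed nonempty. Notation. $\mathcal{A}=(A_1,\dots,A_p)$, $\mathcal{B}=(B_1,\dots,B_q)$, $\mathbf{x}=(x_1;\dots;x_p)$, $\mathbf{y}=(y_1;\dots;y_q)$, $\mathcal{X}=\prod_i\mathcal{X}_i$, $\mathcal{Y}=\prod_j\mathcal{Y}_j$, $\mathcal{M}=\mathcal{X}\times\mathcal{Y}\times\mathbb{R}^n$, $\mathbf{u}=(\mathbf{x};\mathbf{y})$, $\mathbf{w}=(\mathbf{x};\mathbf{y};\lambda)$, $h(\mathbf{u})=\sum_{i=1}^pf_i(x_i)+\sum_{j=1}^qg_j(y_j)$, $\mathcal{J}(\mathbf{w})=(-\mathcal{A}^{\sf T}\lambda;\,-\mathcal{B}^{\sf T}\lambda;\,\mathcal{A}\mathbf{x}+\mathcal{B}\mathbf{y}-c)$.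 For $\beta>0$, $\mathcal{L}_\beta(\mathbf{x},\mathbf{y},\lambda)=h(\mathbf{u})-\langle\lambda,\mathcal{A}\mathbf{x}+\mathcal{B}\mathbf{y}-c\rangle+\frac{\beta}{2}\|\mathcal{A}\mathbf{x}+\mathcal{B}\mathbf{y}-c\|^2$. $\mathcal{M}^*$ is the set of $\mathbf{w}^*\in\mathcal{M}$ with $h(\mathbf{u})-h(\mathbf{u}^* )+\langle\mathbf{w}-\mathbf{w}^*,\mathcal{J}(\mathbf{w}^* )\rangle\ge0$ for all $\mathbf{w}\in\mathcal{M}$. It is assumed that $\mathcal{M}^*\ne\emptyset$. GS-ADMM iteration (parameters $\beta>0,\sigma_1,\sigma_2,\tau,s$). From an initial $\mathbf{w}^0=(\mathbf{x}^0;\mathbf{y}^0;\lambda^0)\in\mathcal{M}$, for $k=0,1,2,\dots$: (1) for each $i$, $x_i^{k+1}=\arg\min_{x_i\in\mathcal{X}_i}\mathcal{L}_\beta(x_1^k,\dots,x_i,\dots,x_p^k,\mathbf{y}^k,\lambda^k)+\frac{\sigma_1\beta}{2}\|A_i(x_i-x_i^k)\|^2$; (2) $\lambda^{k+\frac12}=\lambda^k-\tau\beta(\mathcal{A}\mathbf{x}^{k+1}+\mathcal{B}\mathbf{y}^k-c)$; (3) for each $j$, $y_j^{k+1}=\arg\min_{y_j\in\mathcal{Y}_j}\mathcal{L}_\beta(\mathbf{x}^{k+1},y_1^k,\dots,y_j,\dots,y_q^k,\lambda^{k+\frac12})+\frac{\sigma_2\beta}{2}\|B_j(y_j-y_j^k)\|^2$;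 (4) $\lambda^{k+1}=\lambda^{k+\frac12}-s\beta(\mathcal{A}\mathbf{x}^{k+1}+\mathcal{B}\mathbf{y}^{k+1}-c)$. Here $\mathbf{w}^k=(\mathbf{x}^k;\mathbf{y}^k;\lambda^k)$, and $\widetilde{\mathbf{w}}^k=(\mathbf{x}^{k+1};\mathbf{y}^{k+1};\widetilde\lambda^k)$ with $\widetilde\lambda^k=\lambda^k-\beta(\mathcal{A}\mathbf{x}^{k+1}+\mathcal{B}\mathbf{y}^k-c)$. *)

(* Defs.v *)
From HB Require Import structures.
From mathcomp Require Import all_boot all_order all_algebra.
From mathcomp Require Import all_classical all_reals all_analysis.

Set Implicit Arguments.
Unset Strict Implicit.
Unset Printing Implicit Defensive.

Import Order.TTheory GRing.Theory Num.Theory.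
Import numFieldNormedType.Exports.

Local Open Scope classical_set_scope.
Local Open Scope ring_scope.

(* The norm that MathComp-Analysis puts on matrices is the sup norm, hence the
   separate Euclidean norm. Both induce the same topology. *)
Definition dot (R : realType) (n : nat) (u v : 'cV[R]_n) : R :=
  \sum_(l < n) u l 0 * v l 0.

Definition enorm (R : realType) (n : nat) (u : 'cV[R]_n) : R :=
  Num.sqrt (dot u u).

Definition proper_fun (R : realType) (T : Type) (F : T -> \bar R) : Prop :=
  (exists x, F x < +oo)%E /\ (forall x, -oo < F x)%E.

Definition closed_fun (R : realType) (n : nat) (F : 'cV[R]_n -> \bar R) : Prop :=
  closed [set z : 'cV[R]_n * R^o | (F z.1 <= (z.2 : R)%:E)%E].

(* The functions are real-valued: with [F := EFin \o f] below, properness is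
   automatic, and so is closedness once f is convex. *)
Definition closed_proper_convex (R : realType) (n : nat) (f : 'cV[R]_n -> R) :
    Prop :=
  [/\ closed_fun (EFin \o f), proper_fun (EFin \o f)
    & convex_function setT (f : 'cV[R]_n -> R^o)].

Definition is_argmin (R : realType) (T : Type) (S : set T) (F : T -> R) (z : T) :
    Prop :=
  S z /\ (forall z', S z' -> F z <= F z').

(* (x_1; ...; x_r) in the product of the R^(m_i), with the product topology. *)
Notation blocks R m := (prod_topology (fun i => 'cV[R]_(m i))).

Record problem (R : realType) := Problem {
  nrow : nat;
  xnum : nat;
  ynum : nat;
  xdim : 'I_xnum -> nat;
  ydim : 'I_ynum -> nat;
  xobj : forall i, 'cV[R]_(xdim i) -> R;
  yobj : forall j, 'cV[R]_(ydim j) -> R;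
  xmat : forall i, 'M[R]_(nrow, xdim i);
  ymat : forall j, 'M[R]_(nrow, ydim j);
  rhs : 'cV[R]_nrow;
  xset : forall i, set 'cV[R]_(xdim i);
  yset : forall j, set 'cV[R]_(ydim j)
}.

Section GSADMM.
Context (R : realType) (P : problem R).

Definition xspace : topologicalType := blocks R (@xdim R P).
Definition yspace : topologicalType := blocks R (@ydim R P).
Definition wspace : topologicalType := (xspace * yspace * 'cV[R]_(nrow P))%type.

Implicit Types (x : xspace) (y : yspace) (lam : 'cV[R]_(nrow P)) (w : wspace).

Definition wx w : xspace := w.1.1.
Definition wy w : yspace := w.1.2.
Definition wlam w : 'cV[R]_(nrow P) := w.2.

Definition Ax x : 'cV[R]_(nrow P) := \sum_i xmat i *m x i.
Definition By y : 'cV[R]_(nrow P) := \sum_j ymat j *m y j.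
Definition residual x y : 'cV[R]_(nrow P) := Ax x + By y - rhs P.

Definition objective x y : R := \sum_i xobj (x i) + \sum_j yobj (y j).

Definition in_X x : Prop := forall i, xset (x i).
Definition in_Y y : Prop := forall j, yset (y j).
Definition Mset : set wspace := [set w | in_X (wx w) /\ in_Y (wy w)].

Definition feasible : set (xspace * yspace) :=
  [set u | [/\ residual u.1 u.2 = 0, in_X u.1 & in_Y u.2]].

Definition solutions : set (xspace * yspace) :=
  [set u | is_argmin feasible (fun u => objective u.1 u.2) u].

Definition auglag (beta : R) x y lam : R :=
  objective x y - dot lam (residual x y)
  + beta / 2 * enorm (residual x y) ^+ 2.

Definition J w : wspace :=
  ((fun i => - ((xmat i)^T *m wlam w), fun j => - ((ymat j)^T *m wlam w)),
   residual (wx w) (wy w)).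

(* <w - w', v> for the Euclidean inner product of the whole space. *)
Definition dotB w w' (v : wspace) : R :=
  \sum_i dot (wx w i - wx w' i) (wx v i)
  + \sum_j dot (wy w j - wy w' j) (wy v j)
  + dot (wlam w - wlam w') (wlam v).

Definition Mstar : set wspace :=
  [set ws | Mset ws /\ forall w, Mset w ->
     0 <= objective (wx w) (wy w) - objective (wx ws) (wy ws)
          + dotB w ws (J ws)].

Definition standing_assumptions : Prop :=
  [/\ (0 < xnum P)%N /\ (0 < ynum P)%N,
      (forall i, closed_proper_convex (@xobj R P i))
        /\ (forall j, closed_proper_convex (@yobj R P j)),
      (forall i, \rank (xmat i : 'M[R]_(nrow P, xdim i)) = xdim i)
        /\ (forall j, \rank (ymat j : 'M[R]_(nrow P, ydim j)) = ydim j),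
      (forall i, closed (@xset R P i) /\ convex_set (@xset R P i))
        /\ (forall j, closed (@yset R P j) /\ convex_set (@yset R P j))
    & solutions !=set0 /\ Mstar !=set0].

Definition half_dual (beta tau : R) w w' : 'cV[R]_(nrow P) :=
  wlam w - (tau * beta) *: residual (wx w') (wy w).

(* [w'] is obtained from [w] by one GS-ADMM iteration. *)
Definition gs_admm_step (beta sigma1 sigma2 tau s : R) w w' : Prop :=
  [/\ forall i, is_argmin (@xset R P i)
        (fun z => auglag beta (dfwith (wx w) i z) (wy w) (wlam w)
           + sigma1 * beta / 2 * enorm (xmat i *m (z - wx w i)) ^+ 2)
        (wx w' i),
      forall j, is_argmin (@yset R P j)
        (fun z => auglag beta (wx w') (dfwith (wy w) j z) (half_dual beta tau w w')
           + sigma2 * beta / 2 * enorm (ymat j *m (z - wy w j)) ^+ 2)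
        (wy w' j)
    & wlam w' = half_dual beta tau w w'
                - (s * beta) *: residual (wx w') (wy w')].

Definition gs_admm (beta sigma1 sigma2 tau s : R) (w : nat -> wspace) : Prop :=
  Mset (w 0%N) /\
  forall k, gs_admm_step beta sigma1 sigma2 tau s (w k) (w k.+1).

Definition wtilde (beta : R) (w : nat -> wspace) (k : nat) : wspace :=
  ((wx (w k.+1), wy (w k.+1)),
   wlam (w k) - beta *: residual (wx (w k.+1)) (wy (w k))).

End GSADMM.

Definition stepsize_region (R : realType) : set (R * R) :=
  [set ts | 0 < ts.1 + ts.2 /\
     0 < - ts.1 ^+ 2 - ts.2 ^+ 2 - ts.1 * ts.2 + ts.1 + ts.2 + 1].

(* Main.v *)
Require Import Defs.
From HB Require Import structures.
From mathcomp Require Import all_boot all_order all_algebra.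
From mathcomp Require Import all_classical all_reals all_analysis.
From mathcomp Require Import ring lra.

Set Implicit Arguments.
Unset Strict Implicit.
Unset Printing Implicit Defensive.

Import Order.TTheory GRing.Theory Num.Theory.
Import numFieldNormedType.Exports.

Local Open Scope classical_set_scope.
Local Open Scope ring_scope.

(* The region is symmetric in (tau, s), and any of its points has tau < 1 or
   s < 1. In the second case one cuts the cycle x, lambda, y, lambda half a
   step later and obtains the iteration for the problem with x and y exchanged
   and parameters (s, tau); so let tau < 1. Then the H-norm distance to a saddle
   point, with the residual r and the last y-increment added, is a Lyapunov
   function: with a = B(y^{k+1} - y^k), the cross term <a, r^{k+1}> is controlled
   by comparing the y-optimality conditions of two consecutive iterations, and
   what remains after completing the square is
   (-tau^2 - s^2 - tau s + tau + s + 1) |r^{k+1}|^2. Hence r, a and the proximal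
   increments tend to 0 and the iterates are bounded. A limit along an
   ultrafilter satisfies the blockwise optimality conditions (lower
   semicontinuity is the closedness of the epigraphs), so it lies in M^*; the
   Lyapunov function centred there is monotone and tends to 0 along the
   ultrafilter, hence tends to 0. *)

(** * Euclidean geometry and convexity *)

Section Dot.
Context (R : realType) (n : nat).
Implicit Types u v w : 'cV[R]_n.

Lemma dotC u v : dot u v = dot v u.
Proof. by apply: eq_bigr => l _; rewrite mulrC. Qed.

Lemma dotDl u v w : dot (u + v) w = dot u w + dot v w.
Proof. by rewrite -big_split; apply: eq_bigr => l _; rewrite mxE mulrDl. Qed.

Lemma dotNl u w : dot (- u) w = - dot u w.
Proof. by rewrite -sumrN; apply: eq_bigr => l _; rewrite mxE mulNr. Qed.

Lemma dotZl k u w : dot (k *: u) w = k * dot u w.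
Proof. by rewrite mulr_sumr; apply: eq_bigr => l _; rewrite mxE mulrA. Qed.

Lemma dotDr u v w : dot w (u + v) = dot w u + dot w v.
Proof. by rewrite !(dotC w) dotDl. Qed.

Lemma dotNr u w : dot w (- u) = - dot w u.
Proof. by rewrite !(dotC w) dotNl. Qed.

Lemma dotZr k u w : dot w (k *: u) = k * dot w u.
Proof. by rewrite !(dotC w) dotZl. Qed.

Lemma dot0l w : dot 0 w = 0.
Proof. by rewrite /dot big1 // => l _; rewrite mxE mul0r. Qed.

Lemma dot0r w : dot w 0 = 0.
Proof. by rewrite dotC dot0l. Qed.

Definition dotE := (dotDl, dotDr, dotNl, dotNr, dotZl, dotZr).

Lemma dot_ge0 u : 0 <= dot u u.
Proof. by apply: sumr_ge0 => l _; rewrite -expr2 sqr_ge0. Qed.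

Lemma dot_eq0 u : dot u u = 0 -> u = 0.
Proof.
move=> /eqP; rewrite psumr_eq0 => [/allP u0|l _]; last by rewrite -expr2 sqr_ge0.
apply/matrixP => l j; rewrite ord1 mxE; apply/eqP.
by have := u0 l (mem_index_enum l); rewrite mulf_eq0 orbb.
Qed.

Lemma sqr_enorm u : enorm u ^+ 2 = dot u u.
Proof. by rewrite sqr_sqrtr // dot_ge0. Qed.

Lemma entry_le_dot u l : u l 0 ^+ 2 <= dot u u.
Proof.
rewrite expr2 /dot (bigD1 l) //= lerDl.
by apply: sumr_ge0 => k _; rewrite -expr2 sqr_ge0.
Qed.

(** Three-point identity: with [u] the old point, [v] the new one and [w] the reference, the cross
    term of an optimality inequality becomes a decrease of squared distances to [w] minus the
    squared step. *)
Lemma dot_polar u v w :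
  2 * dot (w - v) (v - u) =
  dot (u - w) (u - w) - dot (v - w) (v - w) - dot (v - u) (v - u).
Proof.
by rewrite !dotE (dotC v u) (dotC w u) (dotC w v); ring.
Qed.

Lemma dotDD_le u v : dot (u + v) (u + v) <= 2 * (dot u u + dot v v).
Proof. by have := dot_ge0 (u - v); rewrite !dotE (dotC v u); lra. Qed.

Lemma dot_suml (I : finType) (f : I -> 'cV[R]_n) w :
  dot (\sum_i f i) w = \sum_i dot (f i) w.
Proof.
by elim/big_rec2 : _ => [|i x y _ <-]; rewrite ?dot0l // dotDl.
Qed.

Lemma dot_sumr (I : finType) (f : I -> 'cV[R]_n) w :
  dot w (\sum_i f i) = \sum_i dot w (f i).
Proof. by rewrite dotC dot_suml; apply: eq_bigr => i _; rewrite dotC. Qed.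

Lemma dot_mulmx m (A : 'M[R]_(n, m)) (u : 'cV[R]_m) w :
  dot (A *m u) w = dot u (A^T *m w).
Proof.
rewrite /dot; under eq_bigr do rewrite mxE mulr_suml.
rewrite exchange_big /=; apply: eq_bigr => l _.
rewrite mxE mulr_sumr; apply: eq_bigr => k _.
by rewrite mxE; ring.
Qed.

End Dot.

Lemma full_rank_left_inverse (F : fieldType) n m (A : 'M[F]_(n, m)) :
  \rank A = m -> exists L, L *m A = 1%:M.
Proof.
move=> rA; have /row_freeP [B AB] : row_free A^T by rewrite /row_free mxrank_tr rA.
by exists B^T; rewrite -(trmxK A) -trmx_mul AB trmx1.
Qed.

Lemma mulmx_entry_bound (R : realType) n m (L : 'M[R]_(m, n)) :
  exists2 C : R, 0 <= C & forall u l, (L *m u) l 0 ^+ 2 <= C * dot u u.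
Proof.
exists (\sum_i dot (row i L)^T (row i L)^T); first by apply: sumr_ge0 => i _; exact: dot_ge0.
move=> u l; have -> : (L *m u) l 0 = dot (row l L)^T u.
  by rewrite mxE; apply: eq_bigr => k _; rewrite !mxE.
apply: (@le_trans _ _ (dot (row l L)^T (row l L)^T * dot u u)); last first.
  apply: ler_wpM2r; first exact: dot_ge0.
  rewrite (bigD1 l) //= lerDl; apply: sumr_ge0 => i _; exact: dot_ge0.
set v := (row l L)^T.
have [/dot_eq0 ->|u0] := eqVneq (dot u u) 0; first by rewrite !dot0r expr0n mulr0.
have upos : 0 < dot u u by rewrite lt_def u0 dot_ge0.
(* Expanding this square gives [dot u u] times the Cauchy-Schwarz gap, and the factor is
   positive. *)
have := dot_ge0 (dot u u *: v - dot v u *: u); rewrite !dotE (dotC u v) => h.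
rewrite -(ler_pM2l upos) -subr_ge0; apply: le_trans h _.
by rewrite le_eqVlt; apply/orP; left; apply/eqP; ring.
Qed.

Section Convexity.
Context (R : realType) (m : nat).

Lemma convex_segment (f : 'cV[R]_m -> R) (S : set 'cV[R]_m)
    (cf : convex_function setT (f : 'cV[R]_m -> R^o)) (cS : convex_set S)
    (z z' : 'cV[R]_m) (t : R) : 0 <= t <= 1 -> S z -> S z' ->
  S (z + t *: (z' - z)) /\ f (z + t *: (z' - z)) <= f z + t * (f z' - f z).
Proof.
move=> /andP[t0 t1] Sz Sz'.
have Et : z + t *: (z' - z) =
    conv (Itv01 t0 t1) (z' : convex_lmodType 'cV[R]_m) z.
  have -> : conv (Itv01 t0 t1) (z' : convex_lmodType 'cV[R]_m) z =
            t *: z' + (1 - t) *: z by [].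
  by rewrite scalerBl scale1r scalerBr addrCA.
rewrite Et; split; first by apply/set_mem/cS; exact/mem_set.
have := cf (Itv01 t0 t1) z' z; rewrite !inE => /(_ I I).
by rewrite convRE /= => /le_trans; apply; rewrite /unstable.onem; lra.
Qed.

Lemma ge0_of_quadratic (D K : R) :
  (forall t, 0 < t -> t <= 1 -> 0 <= t * D + t ^+ 2 * K) -> 0 <= D.
Proof.
move=> h; rewrite leNgt; apply/negP => D0.
(* This [t] solves $t(-D+|K|)=-D$, so at [t / 2] the bracket $D+\frac t2|K|=\frac{1+t}{2}D$ is still
   negative. *)
pose t := - D / (- D + `|K|).
have Kp := normr_ge0 K.
have den : 0 < - D + `|K| by lra.
have t0 : 0 < t by rewrite divr_gt0 //; lra.
have t1 : t <= 1 by rewrite ler_pdivrMr //; lra.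
have := h (t / 2) ltac:(lra) ltac:(lra).
have tE : t * (- D + `|K|) = - D by rewrite divfK // gt_eqF.
have := ler_norm K => KK.
suff : t / 2 * D + (t / 2) ^+ 2 * K < 0 by lra.
have : t / 2 * K <= t / 2 * `|K| by rewrite ler_pM2l //; lra.
move=> hK; have : t / 2 * (D + t / 2 * K) < 0 by rewrite pmulr_rlt0; nra.
by rewrite mulrDr mulrA -expr2.
Qed.

Lemma argmin_vi n (A : 'M[R]_(n, m)) (f : 'cV[R]_m -> R) (S : set 'cV[R]_m)
    (C beta sigma : R) (r lam : 'cV[R]_n) (x0 z0 : 'cV[R]_m) :
  convex_function setT (f : 'cV[R]_m -> R^o) -> convex_set S ->
  is_argmin S (fun z => C + f z - dot lam (r + A *m (z - x0))
     + beta / 2 * enorm (r + A *m (z - x0)) ^+ 2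
     + sigma * beta / 2 * enorm (A *m (z - x0)) ^+ 2) z0 ->
  forall z, S z -> 0 <= f z - f z0 +
    dot (A *m (z - z0))
        ((1 + sigma) * beta *: (A *m (z0 - x0)) - (lam - beta *: r)).
Proof.
move=> cf cS [Sz0 hz0] z Sz; apply: (@ge0_of_quadratic _
  ((1 + sigma) * beta / 2 * dot (A *m (z - z0)) (A *m (z - z0)))) => t t0 t1.
have [St ft] := convex_segment cf cS (introT andP (conj (ltW t0) t1)) Sz0 Sz.
have := hz0 _ St.
have -> : A *m (z0 + t *: (z - z0) - x0) = A *m (z0 - x0) + t *: (A *m (z - z0)).
  by rewrite scalemxAr -mulmxDr addrAC.
rewrite !sqr_enorm.
set p := A *m (z0 - x0); set q := A *m (z - z0).
rewrite !dotE (dotC p r) (dotC q r) (dotC q p) (dotC q lam).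
lra.
Qed.

End Convexity.

(** * Block families *)

Section Blocks.
Context (R : realType) (n p : nat) (m : 'I_p -> nat).
Variable A : forall i, 'M[R]_(n, m i).
Implicit Types u v x : forall i, 'cV[R]_(m i).

Definition img v : 'cV[R]_n := \sum_i A i *m v i.
Definition bsub u v : forall i, 'cV[R]_(m i) := fun i => u i - v i.

(* The quadratic form of the block H_x (or H_y) of the paper, as a bilinear form. *)
Definition prox_form (beta sigma : R) u v : R :=
  beta * ((1 + sigma) * (\sum_i dot (A i *m u i) (A i *m v i))
          - dot (img u) (img v)).

Lemma img_sub u v : img (bsub u v) = img u - img v.
Proof. by rewrite -sumrB; apply: eq_bigr => i _; rewrite mulmxBr. Qed.

Lemma img_dfwith x i (z : 'cV[R]_(m i)) : img (dfwith x i z) = img x + A i *m (z - x i).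
Proof.
rewrite /img (bigD1 i) //= [in RHS](bigD1 i) //= dfwithin mulmxBr.
rewrite [RHS]addrAC [A i *m x i + _]addrC subrK; congr (_ + _).
by apply: eq_bigr => j ji; rewrite dfwithout // eq_sym.
Qed.

Lemma sum_dfwith (f : forall i, 'cV[R]_(m i) -> R) x i (z : 'cV[R]_(m i)) :
  \sum_j f j (dfwith x i z j) = \sum_(j | j != i) f j (x j) + f i z.
Proof.
rewrite (bigD1 i) //= dfwithin addrC; congr (_ + _).
by apply: eq_bigr => j ji; rewrite dfwithout // eq_sym.
Qed.

Lemma prox_form_polar beta sigma z x x' :
  2 * prox_form beta sigma (bsub z x') (bsub x' x) =
  prox_form beta sigma (bsub x z) (bsub x z)
  - prox_form beta sigma (bsub x' z) (bsub x' z)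
  - prox_form beta sigma (bsub x' x) (bsub x' x).
Proof.
have H : 2 * (\sum_i dot (A i *m bsub z x' i) (A i *m bsub x' x i)) =
    \sum_i dot (A i *m bsub x z i) (A i *m bsub x z i)
    - \sum_i dot (A i *m bsub x' z i) (A i *m bsub x' z i)
    - \sum_i dot (A i *m bsub x' x i) (A i *m bsub x' x i).
  rewrite mulr_sumr -!sumrB; apply: eq_bigr => i _.
  by rewrite /bsub !mulmxBr dot_polar.
have K := dot_polar (img x) (img x') (img z).
rewrite /prox_form !img_sub.
rewrite (_ : 2 * _ = beta * ((1 + sigma) *
  (2 * \sum_i dot (A i *m bsub z x' i) (A i *m bsub x' x i))
  - 2 * dot (img z - img x') (img x' - img x))); last by ring.
by rewrite H K; ring.
Qed.

(** The sum of $\|A_iv_i-A_jv_j\|^2$ over all ordered pairs is twice the gap between the two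
    sides. *)
Lemma dot_img_le v :
  dot (img v) (img v) <= p%:R * \sum_i dot (A i *m v i) (A i *m v i).
Proof.
have h : 0 <= \sum_i \sum_j
    dot (A i *m v i - A j *m v j) (A i *m v i - A j *m v j).
  by apply: sumr_ge0 => i _; apply: sumr_ge0 => j _; exact: dot_ge0.
have E : \sum_i \sum_j
    dot (A i *m v i - A j *m v j) (A i *m v i - A j *m v j) =
    2 * (p%:R * \sum_i dot (A i *m v i) (A i *m v i))
    - 2 * dot (img v) (img v).
  rewrite {1}/img dot_suml (_ : 2 * (p%:R * _) =
     \sum_i \sum_(j < p) (dot (A i *m v i) (A i *m v i)
                        + dot (A j *m v j) (A j *m v j))); last first.
    under [RHS]eq_bigr do rewrite big_split /= sumr_const card_ord.
    rewrite big_split /= sumr_const card_ord -mulr_natl.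
    under [X in _ = X + _]eq_bigr do rewrite -mulr_natl.
    by rewrite -mulr_sumr; ring.
  rewrite mulr_sumr -sumrB; apply: eq_bigr => i _.
  rewrite /img dot_sumr mulr_sumr -sumrB; apply: eq_bigr => j _.
  by rewrite !dotE (dotC (A j *m v j) (A i *m v i)); ring.
by move: h; rewrite E; lra.
Qed.

Section Coercivity.
Variables (beta sigma : R).
Hypotheses (beta0 : 0 < beta) (sigma_ge : p%:R - 1 <= sigma).

(** The source of the threshold $p-1$ for the proximal parameter: it is where the factor on the left
    changes sign. *)
Lemma prox_form_ge v : beta * (1 + sigma - p%:R) *
  (\sum_i dot (A i *m v i) (A i *m v i)) <= prox_form beta sigma v v.
Proof.
rewrite /prox_form -mulrA ler_pM2l //; have := dot_img_le v.
by rewrite mulrBl lerD2l lerN2.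
Qed.

Lemma prox_form_ge0 v : 0 <= prox_form beta sigma v v.
Proof.
apply: le_trans (prox_form_ge v); apply: mulr_ge0.
  apply: mulr_ge0; first exact: ltW.
  by rewrite subr_ge0 -lerBlDl.
by apply: sumr_ge0 => i _; exact: dot_ge0.
Qed.

Lemma prox_form_le u v : prox_form beta sigma u v <=
  (prox_form beta sigma u u + prox_form beta sigma v v) / 2.
Proof.
(* Polarization at the reference 0, with the step from [u - v] to [u]; nonnegativity of the form on
   [u - v] then gives the bound. *)
have := prox_form_polar beta sigma (fun=> 0) (bsub u v) u.
have E0 z : bsub z (fun=> 0) = z.
  by apply: functional_extensionality_dep => i; rewrite /bsub subr0.
have -> : bsub u (bsub u v) = v.
  by apply: functional_extensionality_dep => i; rewrite /bsub opprB addrC subrK.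
rewrite !E0 => h; have := prox_form_ge0 (bsub u v).
suff : prox_form beta sigma (bsub (fun=> 0) u) v = - prox_form beta sigma u v.
  by lra.
have img0 : img (fun=> 0) = 0 by rewrite /img big1 // => i _; rewrite mulmx0.
rewrite /prox_form img_sub img0.
rewrite (_ : \sum_i _ = - \sum_i dot (A i *m u i) (A i *m v i)); last first.
  by rewrite -sumrN; apply: eq_bigr => i _; rewrite /bsub sub0r mulmxN dotNl.
by rewrite sub0r dotNl; ring.
Qed.

(* For a single block the form may vanish, but then [A v] is the only block. *)
Lemma block_coercive : p = 1%N \/ p%:R - 1 < sigma ->
  exists2 C, 0 <= C & forall v i, dot (A i *m v i) (A i *m v i) <=
    C * (prox_form beta sigma v v + dot (img v) (img v)).
Proof.
case=> [p1 | hs].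
  exists 1 => // v i; rewrite mul1r.
  have -> : img v = A i *m v i.
    rewrite /img (bigD1 i) //= big1 ?addr0 // => j /negP[]; apply/eqP.
    have o1 (k : 'I_p) : (k : nat) = 0%N.
      by apply/eqP; have := ltn_ord k; rewrite {2}p1 ltnS leqn0.
    by apply/val_inj; rewrite /= !o1.
  by have := prox_form_ge0 v; lra.
have c0 : 0 < beta * (1 + sigma - p%:R) by rewrite mulr_gt0 // subr_gt0 -ltrBlDl.
exists (beta * (1 + sigma - p%:R))^-1; first by rewrite invr_ge0 ltW.
move=> v i; rewrite -(ler_pM2l c0) mulrA divff ?gt_eqF // mul1r.
apply: (@le_trans _ _ (beta * (1 + sigma - p%:R) *
  (\sum_i dot (A i *m v i) (A i *m v i)))).
  rewrite ler_pM2l // (bigD1 i) //= lerDl.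
  by apply: sumr_ge0 => j _; exact: dot_ge0.
by have := prox_form_ge v; have := dot_ge0 (img v); lra.
Qed.

(** Full column rank enters here: a left inverse of each [A i] carries the bound on [A i *m v i]
    over to the entries of [v i]. *)
Lemma block_entry_coercive : p = 1%N \/ p%:R - 1 < sigma ->
  (forall i, \rank (A i) = m i) ->
  exists2 C, 0 <= C & forall v i l, v i l 0 ^+ 2 <=
    C * (prox_form beta sigma v v + dot (img v) (img v)).
Proof.
move=> hs rA; have [C C0 hC] := block_coercive hs.
have /choice[c hc] i : exists c, 0 <= c /\ forall (v : 'cV[R]_(m i)) l,
    v l 0 ^+ 2 <= c * dot (A i *m v) (A i *m v).
  have [L LA] := full_rank_left_inverse (rA i).
  have [c c0 hc] := mulmx_entry_bound L; exists c; split=> // v l.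
  by have := hc (A i *m v) l; rewrite mulmxA LA mul1mx.
exists ((\sum_i c i) * C).
  by rewrite mulr_ge0 // sumr_ge0 // => i _; have [] := hc i.
move=> v i l; have [c0 hci] := hc i.
apply: le_trans (hci (v i) l) _; rewrite -mulrA; apply: ler_pM => //.
  exact: dot_ge0.
rewrite (bigD1 i) //= lerDl; apply: sumr_ge0 => j _; by have [] := hc j.
Qed.

End Coercivity.

(* [x'] results from a Jacobi sweep started at [x]; [mu] is the multiplier seen
   by every block. *)
Definition block_vi (f : forall i, 'cV[R]_(m i) -> R)
    (S : forall i, set 'cV[R]_(m i)) (beta sigma : R) (mu : 'cV[R]_n) x x' :=
  forall i, S i (x' i) /\ forall z, S i z -> 0 <= f i z - f i (x' i) +
    dot (A i *m (z - x' i)) ((1 + sigma) * beta *: (A i *m (x' i - x i)) - mu).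

(** The proximal form subtracts $\beta\langle\mathrm{img},\mathrm{img}\rangle$ from the
    block-diagonal term; adding it back corrects the multiplier to the one of a joint minimization
    over all blocks. *)
Lemma block_vi_sum f S beta sigma mu x x' (z : forall i, 'cV[R]_(m i)) :
  block_vi f S beta sigma mu x x' -> (forall i, S i (z i)) ->
  0 <= \sum_i f i (z i) - \sum_i f i (x' i)
       + prox_form beta sigma (bsub z x') (bsub x' x)
       + dot (img z - img x') (beta *: (img x' - img x) - mu).
Proof.
move=> h Sz; have : 0 <= \sum_i (f i (z i) - f i (x' i) +
    dot (A i *m (z i - x' i))
        ((1 + sigma) * beta *: (A i *m (x' i - x i)) - mu)).
  by apply: sumr_ge0 => i _; have [_] := h i; apply.
rewrite big_split /= sumrB.
suff -> : \sum_i dot (A i *m (z i - x' i))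
        ((1 + sigma) * beta *: (A i *m (x' i - x i)) - mu) =
   prox_form beta sigma (bsub z x') (bsub x' x)
       + dot (img z - img x') (beta *: (img x' - img x) - mu) by rewrite addrA.
under eq_bigr do rewrite dotDr dotNr dotZr.
rewrite sumrB -mulr_sumr -dot_suml -!img_sub -/(img (bsub z x')) /prox_form.
by rewrite dotDr dotNr dotZr; ring.
Qed.

End Blocks.

(** * The Lyapunov inequality *)

Section Energy.
Context (R : realType) (n : nat) (beta tau s : R).
Implicit Types a b l r lam : 'cV[R]_n.
Hypotheses (beta0 : 0 < beta) (ts0 : 0 < tau + s).

(* The [(y, lambda)]-part of the H-norm of the paper, up to the form of the
   y-blocks, after completing the square in [lambda]. *)
Definition potential b l : R :=
  beta * (1 - tau) * dot b b
  + (beta * (tau + s))^-1 * dot (l - (tau * beta) *: b) (l - (tau * beta) *: b).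

Lemma potential_ge0 b l : tau < 1 -> 0 <= potential b l.
Proof.
move=> t1; apply: addr_ge0; apply: mulr_ge0; rewrite ?dot_ge0 //.
  by rewrite mulr_ge0 // ltW // subr_gt0.
by rewrite invr_ge0 mulr_ge0 // ltW.
Qed.

(** The first term controls [b], the second the shifted multiplier $l-\tau\beta b$, and [l] is the
    latter plus $\tau\beta b$. *)
Lemma potential_coercive : tau < 1 -> exists2 C, 0 <= C &
  forall b l, dot b b <= C * potential b l /\ dot l l <= C * potential b l.
Proof.
move=> t1; pose c := beta * (1 - tau); pose d := beta * (tau + s).
have c0 : 0 < c by rewrite mulr_gt0 // subr_gt0.
have d0 : 0 < d by rewrite mulr_gt0.
pose C := c^-1 + 2 * (d + (tau * beta) ^+ 2 * c^-1).
have ci0 : 0 <= c^-1 by rewrite invr_ge0 ltW.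
have C1 : 0 <= 2 * (d + (tau * beta) ^+ 2 * c^-1).
  by rewrite mulr_ge0 // addr_ge0 ?(ltW d0) // mulr_ge0 // sqr_ge0.
exists C; first by rewrite addr_ge0.
move=> b l.
set e := l - (tau * beta) *: b.
have b0 := dot_ge0 b; have e0 := dot_ge0 e.
have hb : dot b b <= c^-1 * potential b l.
  rewrite -(ler_pM2l c0) mulrA divff ?gt_eqF // mul1r lerDl.
  by rewrite mulr_ge0 // invr_ge0 ltW.
have he : dot e e <= d * potential b l.
  rewrite /potential -/e -/d -/c mulrDr mulVKf ?gt_eqF // lerDr.
  by apply: mulr_ge0; [exact: ltW | apply: mulr_ge0 => //; exact: ltW].
have p0 := potential_ge0 b l t1.
split.
  apply: le_trans hb _; rewrite ler_wpM2r // lerDl //.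
have -> : dot l l = dot (e + (tau * beta) *: b) (e + (tau * beta) *: b).
  by rewrite subrK.
apply: le_trans (dotDD_le _ _) _; rewrite !(dotZl, dotZr).
have : (tau * beta) ^+ 2 * dot b b <= (tau * beta) ^+ 2 * (c^-1 * potential b l).
  by rewrite ler_wpM2l // sqr_ge0.
have : 0 <= c^-1 * potential b l by rewrite mulr_ge0.
rewrite /C; move: he.
move: (potential b l) (dot b b) (dot e e) (c^-1) (tau * beta) => P bb ee ci tb.
by clearbody d; lra.
Qed.

(* [a] stands for [B(y' - y)], [r] for the residual at the new point, and
   [ex], [ey] for the values of the proximal forms; [dh] is the gap of
   objectives, eliminated against the saddle-point inequality. *)
Lemma potential_decrease a b l r lam dh ex ey :
  0 <= dh + ex + ey + dot (b + a - r) (beta *: (r - a) - (lam + l))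
       + dot (- (b + a))
             (beta *: a - (lam + l) + ((1 + tau) * beta) *: (r - a)) ->
  0 <= - dh - dot r lam ->
  potential (b + a) (l - (tau * beta) *: (r - a) - (s * beta) *: r) <=
  potential b l + 2 * (ex + ey)
  - beta * ((1 - tau) * dot a a - 2 * (1 - tau) * dot a r
            + (2 - tau - s) * dot r r).
Proof.
move=> h1 h2; rewrite /potential.
(* In the shifted multiplier the increment [a] cancels, and it moves by exactly $-(\tau+s)\beta
   r$. *)
have -> : l - (tau * beta) *: (r - a) - (s * beta) *: r
          - (tau * beta) *: (b + a) =
   (l - (tau * beta) *: b) - ((tau + s) * beta) *: r.
  by apply/matrixP => i j; rewrite !mxE; ring.
have dot_shift e : (beta * (tau + s))^-1 *
    dot (e - ((tau + s) * beta) *: r) (e - ((tau + s) * beta) *: r) =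
    (beta * (tau + s))^-1 * dot e e - 2 * dot e r
    + beta * (tau + s) * dot r r.
  by rewrite !dotE (dotC r e); field; rewrite !gt_eqF.
rewrite dot_shift; set q := _^-1 * dot _ _; clearbody q.
move: h1 h2; rewrite !dotE.
rewrite (dotC a b) (dotC r a) (dotC r l).
lra.
Qed.

(* The cross term is estimated by comparing the y-optimality conditions of two
   consecutive iterations; [r0] is the residual of the old point, [E0], [E1] the
   squared proximal seminorms of the two y-increments. *)
Lemma potential_decrease_cross a r (r0 : 'cV[R]_n) (E0 E1 : R) :
  tau < 1 ->
  (1 + tau) * (beta * dot a r) <=
    beta * (tau * dot a a + (1 - s) * dot a r0) + (E0 - E1) / 2 ->
  - ((1 + tau) * (beta * ((1 - tau) * dot a a - 2 * (1 - tau) * dot a r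
            + (2 - tau - s) * dot r r))) <=
  (1 - tau) * (E0 - E1) + beta * (1 - s) ^+ 2 * (dot r0 r0 - dot r r)
  - beta * dot ((1 - tau) *: a - (1 - s) *: r0) ((1 - tau) *: a - (1 - s) *: r0)
  - beta * (- tau ^+ 2 - s ^+ 2 - tau * s + tau + s + 1) * dot r r.
Proof.
(* Scaled by $2(1-\tau)$, the left side of [h] is the cross term to be removed. The [a]-terms then
   complete the square of $(1-\tau)a-(1-s)r_0$, and $(1+\tau)(2-\tau-s)-(1-s)^2$ is the polynomial
   of the region. *)
move=> lt1 h; have t2 : 0 <= 2 * (1 - tau) by lra.
have := ler_wpM2l t2 h.
rewrite !dotE (dotC r0 a); move: (dot a a) (dot a r) (dot r r) (dot a r0) => *.
lra.
Qed.

End Energy.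

(** * Convergence along filters *)

Section Convergence.
Context (R : realType) (I : Type) (F : set_system I).
Hypothesis FF : Filter F.

Lemma cvg0_of_sqr_le (u d : I -> R) :
  (forall k, u k ^+ 2 <= d k) -> d @ F --> (0 : R) -> u @ F --> (0 : R).
Proof.
move=> ud d0; apply: norm_cvg0.
under eq_fun do rewrite -sqrtr_sqr.
rewrite -(sqrtr0 R); apply: (@continuous_cvg _ _ _ _ _ (fun k => u k ^+ 2)).
  exact: sqrt_continuous.
apply: (@squeeze_cvgr _ _ _ _ (fun=> 0) d) => //; last exact: cvg_cst.
by apply: nearW => k; rewrite sqr_ge0 ud.
Qed.

Lemma cvg_sum_fin (V : normedModType R) (J : finType) (f : J -> I -> V) (z : J -> V) :
  (forall j, f j @ F --> z j) -> (fun k => \sum_j f j k) @ F --> \sum_j z j.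
Proof. by move=> h; apply: cvg_big => [|j _]; [exact: add_continuous | exact: h]. Qed.

Section Columns.
Context (n : nat).
Implicit Types (u v : I -> 'cV[R]_n) (z : 'cV[R]_n).

Lemma cvg_col u z : (forall l, (fun k => u k l 0) @ F --> z l 0) -> u @ F --> z.
Proof.
move=> h A [Q Qz QA]; suff : \forall k \near F, forall i j, Q i j (u k i j).
  by apply: filterS => k Qk; exact: QA.
apply: filter_forall => i; apply: filter_forall => j.
by rewrite ord1; apply: h; rewrite -(ord1 j).
Qed.

Lemma cvg_entry u z l : u @ F --> z -> (fun k => u k l 0) @ F --> z l 0.
Proof.
move=> uz; apply: (@continuous_cvg _ _ _ _ _ u (fun M : 'cV[R]_n => M l 0)) => //.
exact: coord_continuous.
Qed.

Lemma cvg_dot u v z z' : u @ F --> z -> v @ F --> z' ->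
  (fun k => dot (u k) (v k)) @ F --> dot z z'.
Proof. by move=> uz vz; apply: cvg_sum_fin => l; apply: cvgM; exact: cvg_entry. Qed.

Lemma cvg_of_dot_le u z (d : I -> R) :
  (forall k, dot (u k - z) (u k - z) <= d k) -> d @ F --> (0 : R) -> u @ F --> z.
Proof.
move=> ud d0; apply: cvg_col => l; apply/subr_cvg0.
apply: cvg0_of_sqr_le d0 => k; apply: le_trans (ud k).
by have := entry_le_dot (u k - z) l; rewrite !mxE.
Qed.

End Columns.

Lemma cvg_mulmx n m (A : 'M[R]_(n, m)) (u : I -> 'cV[R]_m) z :
  u @ F --> z -> (fun k => A *m u k) @ F --> A *m z.
Proof.
move=> uz; apply: cvg_col => l.
rewrite (_ : (fun k => _) = (fun k => \sum_j A l j * u k j 0)); last first.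
  by apply: functional_extensionality_dep => k; rewrite mxE.
rewrite mxE; apply: cvg_sum_fin => j; apply: cvgM; first exact: cvg_cst.
exact: cvg_entry.
Qed.

Lemma cvg_img n p (m : 'I_p -> nat) (A : forall i, 'M[R]_(n, m i))
    (x : I -> forall i, 'cV[R]_(m i)) z :
  (forall i, (fun k => x k i) @ F --> z i) -> (fun k => img A (x k)) @ F --> img A z.
Proof. by move=> xz; apply: cvg_sum_fin => i; exact: cvg_mulmx. Qed.

Lemma cvg_prox_form n p (m : 'I_p -> nat) (A : forall i, 'M[R]_(n, m i)) beta sigma
    (u v : I -> forall i, 'cV[R]_(m i)) z z' :
  (forall i, (fun k => u k i) @ F --> z i) ->
  (forall i, (fun k => v k i) @ F --> z' i) ->
  (fun k => prox_form A beta sigma (u k) (v k)) @ F --> prox_form A beta sigma z z'.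
Proof.
move=> uz vz; rewrite /prox_form; apply: cvgM; first exact: cvg_cst.
apply: cvgB; last by apply: cvg_dot; exact: cvg_img.
apply: cvgM; first exact: cvg_cst.
by apply: cvg_sum_fin => i; apply: cvg_dot; exact: cvg_mulmx.
Qed.

(** The product topology is the supremum of the initial topologies of the projections, so each
    coordinate can be tested alone. *)
Lemma cvg_blocks p (m : 'I_p -> nat) (x : I -> blocks R m) (z : blocks R m) :
  (forall i, (fun k => x k i) @ F --> z i) -> x @ F --> z.
Proof.
move=> xz; apply/cvg_sup => i U.
have /= -> := @nbhsE (initial_topology (fun f : (forall i, 'cV[R]_(m i)) => f i)) z.
case=> B [[C oC <-] Cz] /filterS; apply; apply: xz.
by rewrite nbhsE; exists C.
Qed.

End Convergence.

Lemma fmap_ultra (I T : Type) (U : set_system I) (u : I -> T) :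
  UltraFilter U -> UltraFilter (u @ U).
Proof.
move=> UU; split=> [|G GG UG]; first exact: fmap_proper_filter.
apply/seteqP; split=> [A GA | A /UG //].
have [//|UnA] := in_ultra_setVsetC (u @^-1` A) UU.
have GnA : G (~` A) by apply: UG.
by have [x [Ax]] := filter_ex (filterI GA GnA).
Qed.

(** The ultrafilter replaces extraction of subsequences: all blocks and the multiplier converge
    along the same one. *)
Lemma ultra_bounded_cvg (R : realType) (I : Type) (U : set_system I) (u : I -> R) C :
  UltraFilter U -> (\forall k \near U, u k ^+ 2 <= C) ->
  exists z : R, u @ U --> z.
Proof.
move=> UU uC; have := @segment_compact R (- (C + 1)) (C + 1).
rewrite compact_ultra => /(_ (u @ U)) [].
- exact: fmap_ultra.
- apply: filterS uC => k /=; rewrite in_itv /= => uC; apply/andP; split; nra.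
- by move=> z [_ uz]; exists z.
Qed.

Lemma ultra_bounded_col_cvg (R : realType) (I : Type) (U : set_system I) n
    (u : I -> 'cV[R]_n) (C : R) :
  UltraFilter U -> (\forall k \near U, forall l, u k l 0 ^+ 2 <= C) ->
  exists z : 'cV[R]_n, u @ U --> z.
Proof.
move=> UU uC; have /choice[z hz] l : exists z : R, (fun k => u k l 0) @ U --> z.
  by apply: (@ultra_bounded_cvg _ _ _ _ C) => //; apply: filterS uC => k; apply.
exists (\col_l z l); apply: cvg_col => l; rewrite mxE; exact: hz.
Qed.

(** The sequence [u] is nonincreasing and bounded below, so its consecutive differences, which
    dominate [d], vanish. *)
Lemma decrease_cvg0 (R : realType) (u d : R ^nat) :
  (forall k, 0 <= u k) -> (forall k, 0 <= d k) ->
  (forall k, u k.+1 <= u k - d k) -> d @ \oo --> (0 : R).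
Proof.
move=> u0 d0 ud.
have /cvg_ex[l ul] : cvgn u.
  apply: nonincreasing_is_cvgn.
    by apply/nonincreasing_seqP => k; have := ud k; have := d0 k; lra.
  by exists 0 => _ [k _ <-].
apply: (@squeeze_cvgr _ _ _ _ (fun=> 0) (fun k => u k - u k.+1)).
- by apply: nearW => k; rewrite d0 /=; have := ud k; lra.
- exact: cvg_cst.
- rewrite -(subrr l); apply: cvgB => //.
  by rewrite (cvg_shiftS u).
Qed.

(** Properness of [U] yields one index where [u] is below [e]; monotonicity keeps it there. *)
Lemma nonincreasing_cvg0_finer (R : realType) (u : R ^nat) (U : set_system nat) :
  ProperFilter U -> (forall k, 0 <= u k) -> (forall k, u k.+1 <= u k) ->
  u @ U --> (0 : R) -> u @ \oo --> (0 : R).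
Proof.
move=> UU u0 ud uU; apply/cvgrPdist_lt => e e0.
have /cvgrPdist_lt/(_ e e0)/filter_ex [N] := uU.
rewrite sub0r normrN => uN; exists N => // k /= Nk.
rewrite sub0r normrN; apply: le_lt_trans uN.
rewrite !ger0_norm //; have /nonincreasing_seqP h := ud; exact: h.
Qed.

(** * Optimality conditions *)

(** The pairs formed by [u k] and [al k] stay in the closed epigraph of [f]. *)
Lemma closed_fun_limit (R : realType) (I : Type) (U : set_system I) n
    (f : 'cV[R]_n -> R) (u : I -> 'cV[R]_n) (al : I -> R) z a :
  ProperFilter U -> closed_fun (EFin \o f) ->
  u @ U --> z -> al @ U --> a -> (forall k, f (u k) <= al k) -> f z <= a.
Proof.
move=> UU cf uz ala h.
have cpair : (fun k => (u k, al k : R^o)) @ U --> (z, a : R^o).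
  exact: (cvg_pair uz ala).
have := closed_cvg _ cf _ _ cpair; rewrite /= lee_fin; apply.
by apply: nearW => k /=; rewrite lee_fin.
Qed.

(** The proximal term dies with the increments, leaving the limit multiplier. The value of [f i] at
    the moving point sits on the smaller side, so lower semicontinuity suffices. *)
Lemma block_vi_limit (R : realType) (I : Type) (U : set_system I) n p
    (m : 'I_p -> nat) (A : forall i, 'M[R]_(n, m i))
    (f : forall i, 'cV[R]_(m i) -> R) (S : forall i, set 'cV[R]_(m i))
    (beta sigma : R) (mu : I -> 'cV[R]_n) (x x' : I -> forall i, 'cV[R]_(m i))
    mulim (z : forall i, 'cV[R]_(m i)) :
  ProperFilter U ->
  (forall i, closed_fun (EFin \o f i)) -> (forall i, closed (S i)) ->
  (forall k, block_vi A f S beta sigma (mu k) (x k) (x' k)) ->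
  mu @ U --> mulim -> (forall i, (fun k => x' k i) @ U --> z i) ->
  (forall i, (fun k => A i *m (x' k i - x k i)) @ U --> (0 : 'cV[R]_n)) ->
  forall i, S i (z i) /\ forall y, S i y ->
    0 <= f i y - f i (z i) - dot (A i *m (y - z i)) mulim.
Proof.
move=> UU cf cS vi cmu cx cdx i; split.
  apply: (closed_cvg (S i) (cS i) _ _ (cx i)).
  by apply: nearW => k; have [] := vi k i.
move=> y Sy; rewrite addrAC subr_ge0.
pose al k := f i y + dot (A i *m (y - x' k i))
  ((1 + sigma) * beta *: (A i *m (x' k i - x k i)) - mu k).
apply: (@closed_fun_limit _ _ U _ (f i) (fun k => x' k i) al) => //.
- rewrite -dotNr -[- mulim]add0r -(scaler0 _ ((1 + sigma) * beta)).
  apply: cvgD; first exact: cvg_cst.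
  apply: cvg_dot; first by apply: cvg_mulmx; apply: cvgB; [exact: cvg_cst | exact: cx].
  apply: cvgB; last exact: cmu.
  by apply: cvgZ; [exact: cvg_cst | exact: cdx].
- by move=> k; have [_ /(_ y Sy)] := vi k i; rewrite /al; lra.
Qed.

(** * The inequalities of one iteration and the characterization of $\mathcal{M}^*$ *)

Section Problem.
Context (R : realType) (P : problem R).
Implicit Types (x : xspace P) (y : yspace P) (lam : 'cV[R]_(nrow P)).
Implicit Types (w ws : wspace P).

Definition xform (beta sigma : R) (u : xspace P) : R :=
  prox_form (@xmat R P) beta sigma u u.
Definition yform (beta sigma : R) (u : yspace P) : R :=
  prox_form (@ymat R P) beta sigma u u.

Lemma residual_dfwithx x y i (z : 'cV[R]_(xdim i)) :
  residual (dfwith x i z : xspace P) y = residual x y + xmat i *m (z - x i).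
Proof.
rewrite /residual (_ : Ax _ = Ax x + xmat i *m (z - x i)); last exact: img_dfwith.
by rewrite [X in X - _]addrAC [LHS]addrAC.
Qed.

Lemma residual_dfwithy x y j (z : 'cV[R]_(ydim j)) :
  residual x (dfwith y j z : yspace P) = residual x y + ymat j *m (z - y j).
Proof.
rewrite /residual (_ : By _ = By y + ymat j *m (z - y j)); last exact: img_dfwith.
by rewrite addrA [LHS]addrAC.
Qed.

Section Step.
Hypothesis hP : standing_assumptions P.
Variables (beta sigma1 sigma2 tau s : R) (w w' : wspace P).
Hypothesis hw : gs_admm_step beta sigma1 sigma2 tau s w w'.

Lemma gs_admm_step_x : block_vi (@xmat R P) (@xobj R P) (@xset R P) beta sigma1
  (wlam w - beta *: residual (wx w) (wy w)) (wx w) (wx w').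
Proof.
have [_ [cf _] _ [cS _] _] := hP; have [argx _ _] := hw.
move=> i; split; first by have [] := argx i.
have [_ _ cfi] := cf i; have [_ cSi] := cS i.
apply: (@argmin_vi _ _ _ _ (xobj (i := i)) (xset (i := i))
  (\sum_(j | j != i) xobj (wx w j) + \sum_j yobj (wy w j))) => //.
have [Sx hx] := argx i; split=> // z Sz; have := hx z Sz.
rewrite /auglag !residual_dfwithx /objective.
rewrite !(@sum_dfwith R _ _ (fun i => @xobj R P i)).
by rewrite !(addrAC _ (xobj _)).
Qed.

Lemma gs_admm_step_y : block_vi (@ymat R P) (@yobj R P) (@yset R P) beta sigma2
  (half_dual beta tau w w' - beta *: residual (wx w') (wy w)) (wy w) (wy w').
Proof.
have [_ [_ cf] _ [_ cS] _] := hP; have [_ argy _] := hw.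
move=> j; split; first by have [] := argy j.
have [_ _ cfj] := cf j; have [_ cSj] := cS j.
apply: (@argmin_vi _ _ _ _ (yobj (j := j)) (yset (j := j))
  (\sum_i xobj (wx w' i) + \sum_(i | i != j) yobj (wy w i))) => //.
have [Sy hy] := argy j; split=> // z Sz; have := hy z Sz.
rewrite /auglag !residual_dfwithy /objective.
by rewrite !(@sum_dfwith R _ _ (fun i => @yobj R P i)) !addrA.
Qed.

End Step.

Lemma dotB_J w ws : dotB w ws (J ws) =
  - dot (Ax (wx w) + By (wy w) - (Ax (wx ws) + By (wy ws))) (wlam ws)
  + dot (wlam w - wlam ws) (residual (wx ws) (wy ws)).
Proof.
rewrite /dotB; congr (_ + _).
have Ex : \sum_i dot (wx w i - wx ws i) (wx (J ws) i) =
    - dot (Ax (wx w) - Ax (wx ws)) (wlam ws).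
  rewrite -sumrB dot_suml -sumrN; apply: eq_bigr => i _.
  by rewrite -mulmxBr dot_mulmx -dotNr.
have Ey : \sum_j dot (wy w j - wy ws j) (wy (J ws) j) =
    - dot (By (wy w) - By (wy ws)) (wlam ws).
  rewrite -sumrB dot_suml -sumrN; apply: eq_bigr => i _.
  by rewrite -mulmxBr dot_mulmx -dotNr.
by rewrite Ex Ey !dotE; ring.
Qed.

Lemma Mstar_residual ws : Mstar ws -> residual (wx ws) (wy ws) = 0.
Proof.
move=> [[Xs Ys] hs]; apply: dot_eq0.
(* Moving only the multiplier, by minus the residual, reduces the variational inequality to
   $-\|r\|^2\ge0$. *)
have := hs ((wx ws, wy ws), wlam ws - residual (wx ws) (wy ws)) (conj Xs Ys).
rewrite dotB_J /= subrr add0r subrr dot0l oppr0 add0r.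
rewrite [_ - _ - _]addrAC subrr add0r dotNl oppr_ge0 => h.
by apply/eqP; rewrite eq_le h dot_ge0.
Qed.

(** Here the multiplier is kept and only the primal part is moved; feasibility of [ws] turns the
    difference of images into the residual. *)
Lemma Mstar_gap ws x y : Mstar ws -> in_X x -> in_Y y ->
  0 <= objective x y - objective (wx ws) (wy ws)
       - dot (residual x y) (wlam ws).
Proof.
move=> hs Xx Yy; have r0 := Mstar_residual hs; have [_ h] := hs.
have := h ((x, y), wlam ws) (conj Xx Yy).
rewrite dotB_J /= subrr dot0l addr0.
by rewrite (_ : _ - (_ + _) = residual x y) // -[RHS]subr0 -r0 /residual opprB addrA subrK.
Qed.

Lemma Mstar_intro ws : residual (wx ws) (wy ws) = 0 ->
  (forall i, xset (wx ws i) /\ forall z, xset z -> 0 <= xobj z - xobj (wx ws i)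
     - dot (xmat i *m (z - wx ws i)) (wlam ws)) ->
  (forall j, yset (wy ws j) /\ forall z, yset z -> 0 <= yobj z - yobj (wy ws j)
     - dot (ymat j *m (z - wy ws j)) (wlam ws)) ->
  Mstar ws.
Proof.
move=> r0 hx hy; split.
  by split=> [i | j]; [have [] := hx i | have [] := hy j].
move=> w [Xw Yw]; rewrite dotB_J r0 dot0r addr0.
have : 0 <= \sum_i (xobj (wx w i) - xobj (wx ws i)
     - dot (xmat i *m (wx w i - wx ws i)) (wlam ws)).
  by apply: sumr_ge0 => i _; have [_] := hx i; apply.
have : 0 <= \sum_j (yobj (wy w j) - yobj (wy ws j)
     - dot (ymat j *m (wy w j - wy ws j)) (wlam ws)).
  by apply: sumr_ge0 => i _; have [_] := hy i; apply.
rewrite !sumrB -!dot_suml.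
rewrite (_ : \sum_j ymat j *m _ = By (wy w) - By (wy ws)); last first.
  by rewrite -sumrB; apply: eq_bigr => j _; rewrite mulmxBr.
rewrite (_ : \sum_i xmat i *m _ = Ax (wx w) - Ax (wx ws)); last first.
  by rewrite -sumrB; apply: eq_bigr => j _; rewrite mulmxBr.
rewrite /objective !dotE; lra.
Qed.

End Problem.

(** * Descent along the iteration *)

Lemma prox_form_bsubv (R : realType) (n p : nat) (m : 'I_p -> nat)
    (A : forall i, 'M[R]_(n, m i)) beta sigma u (v : forall i, 'cV[R]_(m i)) :
  prox_form A beta sigma (bsub u u) v = 0.
Proof.
rewrite /prox_form img_sub subrr dot0l big1 ?mulr0 ?subr0 ?mulr0 // => i _.
by rewrite /bsub subrr mulmx0 dot0l.
Qed.

(** With $u=\tau+s$ the polynomial is $-u^2+u(1+\tau)+(1-\tau^2)$, where no term is positive if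
    $\tau\le-1$. This makes [1 + tau] a legitimate weight in the Lyapunov function. *)
Lemma stepsize_gt (R : realType) (tau s : R) : 0 < tau + s ->
  0 < - tau ^+ 2 - s ^+ 2 - tau * s + tau + s + 1 -> -1 < tau.
Proof.
move=> h1 h2; rewrite ltNge; apply/negP => h.
have p1 : 0 <= (-1 - tau) * (tau + s) by rewrite mulr_ge0 //; lra.
have p2 : 0 <= (-1 - tau) * (1 - tau) by rewrite mulr_ge0 //; lra.
by have := sqr_ge0 (tau + s); nra.
Qed.

Section Core.
Context (R : realType) (P : problem R).
Hypothesis hP : standing_assumptions P.
Variables (beta sigma1 sigma2 tau s : R) (w : nat -> wspace P).
Hypotheses (beta0 : 0 < beta) (ts0 : 0 < tau + s) (tau1 : tau < 1)
  (region : 0 < - tau ^+ 2 - s ^+ 2 - tau * s + tau + s + 1)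
  (sx : (xnum P)%:R - 1 <= sigma1) (sy : (ynum P)%:R - 1 <= sigma2)
  (sx' : xnum P = 1%N \/ (xnum P)%:R - 1 < sigma1)
  (sy' : ynum P = 1%N \/ (ynum P)%:R - 1 < sigma2)
  (hw : gs_admm beta sigma1 sigma2 tau s w).

Local Notation xx k := (wx (w k)).
Local Notation yy k := (wy (w k)).
Local Notation ll k := (wlam (w k)).
Local Notation r k := (residual (wx (w k)) (wy (w k))).
Local Notation a k := (By (wy (w k.+1)) - By (wy (w k))).
Local Notation xf := (@xform R P beta sigma1).
Local Notation yf := (@yform R P beta sigma2).

Let taup : 0 < 1 + tau.
Proof. by have := stepsize_gt ts0 region; lra. Qed.

Lemma img_Ax (x : xspace P) : img (@xmat R P) x = Ax x. Proof. by []. Qed.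

Lemma img_By (y : yspace P) : img (@ymat R P) y = By y. Proof. by []. Qed.

Lemma iterate_X k : in_X (xx k).
Proof.
case: k => [|k]; first by have [[]] := hw.
by move=> i; have [_ /(_ k)[/(_ i)[]]] := hw.
Qed.

Lemma iterate_Y k : in_Y (yy k).
Proof.
case: k => [|k]; first by have [[]] := hw.
by move=> j; have [_ /(_ k)[_ /(_ j)[]]] := hw.
Qed.

Lemma residual_half k : residual (xx k.+1) (yy k) = r k.+1 - a k.
Proof.
rewrite /residual; move: (Ax _) (By _) (By _) => u v v'.
by apply/matrixP => i j; rewrite !mxE; ring.
Qed.

Lemma iterate_lam k : ll k.+1 =
  ll k - (tau * beta) *: (r k.+1 - a k) - (s * beta) *: r k.+1.
Proof. by have [_ /(_ k)[_ _ ->]] := hw; rewrite /half_dual residual_half. Qed.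

Lemma iterate_vi_x k : block_vi (@xmat R P) (@xobj R P) (@xset R P) beta sigma1
  (ll k - beta *: r k) (xx k) (xx k.+1).
Proof. by have [_ /(_ k) hk] := hw; exact: gs_admm_step_x hk. Qed.

Lemma iterate_vi_y k : block_vi (@ymat R P) (@yobj R P) (@yset R P) beta sigma2
  (ll k.+1 + (s * beta) *: r k.+1 - beta *: (r k.+1 - a k)) (yy k) (yy k.+1).
Proof.
have [_ /(_ k) hk] := hw; have := gs_admm_step_y hP hk.
by rewrite residual_half iterate_lam subrK /half_dual residual_half.
Qed.

(** Written with the new multiplier, the y-increment drops out of the coupling term, which makes two
    consecutive iterations comparable. *)
Lemma iterate_vi_y_sum k (z : yspace P) : in_Y z ->
  0 <= \sum_j yobj (z j) - \sum_j yobj (yy k.+1 j)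
       + prox_form (@ymat R P) beta sigma2 (bsub z (yy k.+1)) (bsub (yy k.+1) (yy k))
       + dot (By z - By (yy k.+1)) (((1 - s) * beta) *: r k.+1 - ll k.+1).
Proof.
move=> Yz; have := block_vi_sum (iterate_vi_y k) Yz; rewrite !img_By.
rewrite (_ : beta *: _ - _ = ((1 - s) * beta) *: r k.+1 - ll k.+1) //.
move: (r _) (By _) (By _) (ll _) => u v v' u'.
by apply/matrixP => i j; rewrite !mxE; ring.
Qed.

Definition dist ws k : R :=
  potential beta tau s (By (yy k) - By (wy ws)) (ll k - wlam ws)
  + xf (bsub (xx k) (wx ws)) + yf (bsub (yy k) (wy ws)).

(** Sum of three inequalities: the x- and y-optimality conditions tested at [ws], and the
    saddle-point inequality of [ws] tested at the new iterate. The polar identities convert the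
    proximal cross terms. *)
Lemma dist_decrease ws k : Mstar ws -> dist ws k.+1 <= dist ws k
  - xf (bsub (xx k.+1) (xx k)) - yf (bsub (yy k.+1) (yy k))
  - beta * ((1 - tau) * dot (a k) (a k) - 2 * (1 - tau) * dot (a k) (r k.+1)
            + (2 - tau - s) * dot (r k.+1) (r k.+1)).
Proof.
move=> hs; have r0 := Mstar_residual hs; have [[Xs Ys] _] := hs.
have hx := block_vi_sum (iterate_vi_x k) Xs; rewrite !img_Ax in hx.
have hy := iterate_vi_y_sum k Ys.
have gap := Mstar_gap hs (iterate_X k.+1) (iterate_Y k.+1).
have ex := prox_form_polar (@xmat R P) beta sigma1 (wx ws) (xx k) (xx k.+1).
have ey := prox_form_polar (@ymat R P) beta sigma2 (wy ws) (yy k) (yy k.+1).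
set ax := prox_form _ _ _ (bsub (wx ws) _) _ in hx ex.
set ay := prox_form _ _ _ (bsub (wy ws) _) _ in hy ey.
have := @potential_decrease R _ beta tau s beta0 ts0 (a k)
  (By (yy k) - By (wy ws)) (ll k - wlam ws) (r k.+1) (wlam ws)
  (objective (wx ws) (wy ws) - objective (xx k.+1) (yy k.+1)) ax ay.
have cE : rhs P = Ax (wx ws) + By (wy ws) by apply/esym/eqP; rewrite -subr_eq0; apply/eqP.
(* The rewrites that follow match the vectors in [potential_decrease] with those in [hx] and [hy];
   feasibility of [ws] eliminates the right-hand side. *)
have -> : By (yy k) - By (wy ws) + a k = By (yy k.+1) - By (wy ws).
  by rewrite addrC addrA subrK.
have -> : By (yy k.+1) - By (wy ws) - r k.+1 = Ax (wx ws) - Ax (xx k.+1).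
  rewrite /residual cE; move: (Ax _) (Ax _) (By _) (By _) => ? ? ? ?.
  by apply/matrixP => i j; rewrite !mxE; ring.
have -> : beta *: (r k.+1 - a k) - (wlam ws + (ll k - wlam ws)) =
   beta *: (Ax (xx k.+1) - Ax (xx k)) - (ll k - beta *: r k).
  rewrite /residual; move: (Ax _) (Ax _) (By _) (By _) => ? ? ? ?.
  by apply/matrixP => i j; rewrite !mxE; ring.
have -> : beta *: a k - (wlam ws + (ll k - wlam ws))
     + ((1 + tau) * beta) *: (r k.+1 - a k) =
   ((1 - s) * beta) *: r k.+1 - ll k.+1.
  rewrite iterate_lam; move: (r _) (By _) (By _) => ? ? ?.
  by apply/matrixP => i j; rewrite !mxE; ring.
rewrite (opprB (By (yy k.+1))).
have -> : ll k - wlam ws - (tau * beta) *: (r k.+1 - a k)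
          - (s * beta) *: r k.+1 = ll k.+1 - wlam ws.
  rewrite iterate_lam; move: (r _) (By _) (By _) => ? ? ?.
  by apply/matrixP => i j; rewrite !mxE; ring.
move=> h; rewrite /dist /xform /yform.
have {}h := h _ _.
apply: le_trans (_ : _ <= potential beta tau s (By (yy k) - By (wy ws))
  (ll k - wlam ws) + 2 * (ax + ay) - beta * ((1 - tau) * dot (a k) (a k) -
   2 * (1 - tau) * dot (a k) (r k.+1) + (2 - tau - s) * dot (r k.+1) (r k.+1))
   + prox_form (@xmat R P) beta sigma1 (bsub (xx k.+1) (wx ws)) (bsub (xx k.+1) (wx ws))
   + prox_form (@ymat R P) beta sigma2 (bsub (yy k.+1) (wy ws)) (bsub (yy k.+1) (wy ws))) _.
  rewrite !lerD2r; apply: h.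
    by move: hx hy; rewrite /objective; lra.
  by move: gap; lra.
by move: ex ey; lra.
Qed.

(** The y-condition of each of two consecutive iterations is tested at the y-iterate produced by the
    other. The objectives cancel in the sum, and the multiplier difference is expressed by
    residuals. *)
Lemma cross_term k :
  (1 + tau) * (beta * dot (a k.+1) (r k.+2)) <=
  beta * (tau * dot (a k.+1) (a k.+1) + (1 - s) * dot (a k.+1) (r k.+1))
  + (yf (bsub (yy k.+1) (yy k)) - yf (bsub (yy k.+2) (yy k.+1))) / 2.
Proof.
have h1 := iterate_vi_y_sum k.+1 (iterate_Y k.+1).
have h2 := iterate_vi_y_sum k (iterate_Y k.+2).
have e1 := prox_form_polar (@ymat R P) beta sigma2 (yy k.+1) (yy k.+1) (yy k.+2).
(* [e1] contributes minus the new squared seminorm, and [e2] bounds the mixed term by half the sum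
   of both; together they give the half difference in the statement. *)
rewrite prox_form_bsubv in e1.
have e2 := prox_form_le (@ymat R P) beta0 sy (bsub (yy k.+2) (yy k.+1))
  (bsub (yy k.+1) (yy k)).
have lamE := iterate_lam k.+1.
move: h1; rewrite lamE -(opprB (By (yy k.+2))) => h1.
move: h1 h2 e1 e2; rewrite /yform.
rewrite !dotE.
lra.
Qed.


(** It starts at iterate [k.+1] because it contains the last y-increment, and y-optimality holds
    only after one iteration. The last two terms absorb the telescoping differences of
    [potential_decrease_cross]. *)
Definition lyap ws k : R := (1 + tau) * dist ws k.+1
  + beta * (1 - s) ^+ 2 * dot (r k.+1) (r k.+1)
  + (1 - tau) * yf (bsub (yy k.+1) (yy k)).

Definition lyap_drop k : R :=
  (1 + tau) * (xf (bsub (xx k.+2) (xx k.+1)) + yf (bsub (yy k.+2) (yy k.+1)))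
  + beta * dot ((1 - tau) *: a k.+1 - (1 - s) *: r k.+1)
               ((1 - tau) *: a k.+1 - (1 - s) *: r k.+1)
  + beta * (- tau ^+ 2 - s ^+ 2 - tau * s + tau + s + 1)
    * dot (r k.+2) (r k.+2).

Lemma lyap_decrease ws k : Mstar ws -> lyap ws k.+1 <= lyap ws k - lyap_drop k.
Proof.
move=> hs; have h1 := dist_decrease k.+1 hs.
have h2 := potential_decrease_cross tau1 (cross_term k).
have := ler_wpM2l (ltW taup) h1; rewrite /lyap /lyap_drop.
move: h2; set g := beta * (_ - _ + _); set e := dot (_ - _ *: _) _.
clearbody g e; lra.
Qed.

Let xf_ge0 u : 0 <= xf u. Proof. exact: prox_form_ge0. Qed.
Let yf_ge0 u : 0 <= yf u. Proof. exact: prox_form_ge0. Qed.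

Lemma dist_ge0 ws k : 0 <= dist ws k.
Proof. by do 2 apply: addr_ge0 => //; exact: potential_ge0. Qed.

Let lyap_terms_ge0 k : [/\ 0 <= beta * (1 - s) ^+ 2 * dot (r k.+1) (r k.+1)
  & 0 <= (1 - tau) * yf (bsub (yy k.+1) (yy k))].
Proof.
split; last by rewrite mulr_ge0 // subr_ge0 ltW.
by apply: mulr_ge0; [apply: mulr_ge0; [exact: ltW | exact: sqr_ge0] | exact: dot_ge0].
Qed.

Lemma dist_le_lyap ws k : (1 + tau) * dist ws k.+1 <= lyap ws k.
Proof. by have [h1 h2] := lyap_terms_ge0 k; rewrite /lyap; lra. Qed.

Lemma lyap_ge0 ws k : 0 <= lyap ws k.
Proof. by apply: le_trans (dist_le_lyap ws k); rewrite mulr_ge0 ?dist_ge0 // ltW. Qed.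

Let drop_terms_ge0 k : [/\ 0 <= (1 + tau) * xf (bsub (xx k.+2) (xx k.+1)),
  0 <= (1 + tau) * yf (bsub (yy k.+2) (yy k.+1)),
  0 <= beta * dot ((1 - tau) *: a k.+1 - (1 - s) *: r k.+1)
               ((1 - tau) *: a k.+1 - (1 - s) *: r k.+1)
  & 0 <= beta * (- tau ^+ 2 - s ^+ 2 - tau * s + tau + s + 1)
    * dot (r k.+2) (r k.+2)].
Proof.
split; try by rewrite mulr_ge0 // ltW.
  by rewrite mulr_ge0 ?dot_ge0 // ltW.
by apply: mulr_ge0; [apply: mulr_ge0; exact: ltW | exact: dot_ge0].
Qed.

Lemma lyap_drop_ge0 k : 0 <= lyap_drop k.
Proof. by have [h1 h2 h3 h4] := drop_terms_ge0 k; rewrite /lyap_drop; lra. Qed.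

Lemma lyap_drop_cvg0 : lyap_drop @ \oo --> (0 : R).
Proof.
have [_ _ _ _ [_ [ws hs]]] := hP.
apply: (@decrease_cvg0 _ (lyap ws)) => k; first exact: lyap_ge0.
  exact: lyap_drop_ge0.
exact: lyap_decrease.
Qed.

Let drop_part_cvg0 (c : R) (u : R ^nat) : 0 < c ->
  (forall k, 0 <= u k) ->
  (forall k, c * u k.+1 <= lyap_drop k) -> u @ \oo --> (0 : R).
Proof.
move=> c0 u0 hu; rewrite -(cvg_shiftS u).
apply: (@squeeze_cvgr _ _ _ _ (fun=> 0) (fun k => c^-1 * lyap_drop k)).
- apply: nearW => k; rewrite u0 /=.
  by rewrite -(ler_pM2l c0) mulrA divff ?gt_eqF // mul1r.
- exact: cvg_cst.
- rewrite -(mulr0 c^-1); apply: cvgM; [exact: cvg_cst | exact: lyap_drop_cvg0].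
Qed.

Lemma xf_increment_cvg0 : (fun k => xf (bsub (xx k.+1) (xx k))) @ \oo --> (0 : R).
Proof.
apply: (drop_part_cvg0 taup) => // k.
by have [h1 h2 h3 h4] := drop_terms_ge0 k; rewrite /lyap_drop; lra.
Qed.

Lemma yf_increment_cvg0 : (fun k => yf (bsub (yy k.+1) (yy k))) @ \oo --> (0 : R).
Proof.
apply: (drop_part_cvg0 taup) => // k.
by have [h1 h2 h3 h4] := drop_terms_ge0 k; rewrite /lyap_drop; lra.
Qed.

Lemma dot_residual_cvg0 : (fun k => dot (r k) (r k)) @ \oo --> (0 : R).
Proof.
rewrite -(cvg_shiftS (fun k => dot (r k) (r k))).
have : (fun k => dot (r k.+1) (r k.+1)) @ \oo --> (0 : R); last exact.
apply: (drop_part_cvg0 (mulr_gt0 beta0 region)) => k; first exact: dot_ge0.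
by have [h1 h2 h3 h4] := drop_terms_ge0 k; rewrite /lyap_drop; lra.
Qed.

Lemma residual_cvg0 : (fun k => r k) @ \oo --> (0 : 'cV[R]_(nrow P)).
Proof.
by apply: cvg_of_dot_le dot_residual_cvg0 => k; rewrite subr0.
Qed.

(** The Lyapunov drop controls only the combination $(1-\tau)a-(1-s)r$; as $r\to0$ and $\tau<1$, the
    increment itself tends to 0. *)
Lemma By_increment_cvg0 : (fun k => a k) @ \oo --> (0 : 'cV[R]_(nrow P)).
Proof.
have t0 : 1 - tau != 0 by rewrite subr_eq0 gt_eqF.
pose e k := (1 - tau) *: a k - (1 - s) *: r k.
have e0 : e @ \oo --> (0 : 'cV[R]_(nrow P)).
  apply: (@cvg_of_dot_le _ _ _ _ _ _ _ (fun k => dot (e k) (e k))) => [k|].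
    by rewrite subr0.
  apply: (drop_part_cvg0 beta0) => k; first exact: dot_ge0.
  by have [h1 h2 h3 h4] := drop_terms_ge0 k; rewrite /lyap_drop -/(e k.+1) in h3 *; lra.
have -> : (fun k => a k) = (fun k => (1 - tau)^-1 *: (e k + (1 - s) *: r k)).
  by apply: functional_extensionality_dep => k; rewrite subrK scalerK.
rewrite -(scaler0 _ (1 - tau)^-1); apply: cvgZ; first exact: cvg_cst.
rewrite -(addr0 0); apply: cvgD => //.
rewrite -(scaler0 _ (1 - s)); apply: cvgZ; first exact: cvg_cst.
exact: residual_cvg0.
Qed.

(** [block_coercive] asks for the image besides the proximal form; the image is recovered from two
    residuals and the y-increment. *)
Lemma Ax_increment_cvg0 :
  (fun k => Ax (xx k.+1) - Ax (xx k)) @ \oo --> (0 : 'cV[R]_(nrow P)).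
Proof.
have -> : (fun k => Ax (xx k.+1) - Ax (xx k)) = (fun k => r k.+1 - r k - a k).
  apply: functional_extensionality_dep => k; rewrite /residual.
  move: (Ax _) (Ax _) (By _) (By _) => ? ? ? ?.
  by apply/matrixP => i j; rewrite !mxE; ring.
rewrite -(subr0 0); apply: cvgB; last exact: By_increment_cvg0.
rewrite -(subr0 0); apply: cvgB; last exact: residual_cvg0.
by rewrite (cvg_shiftS (fun k => r k)); exact: residual_cvg0.
Qed.

Lemma xblock_increment_cvg0 i :
  (fun k => xmat i *m (xx k.+1 i - xx k i)) @ \oo --> (0 : 'cV[R]_(nrow P)).
Proof.
have [C C0 hC] := block_coercive (@xmat R P) beta0 sx sx'.
apply: (@cvg_of_dot_le _ _ _ _ _ _ _ (fun k => C * (xf (bsub (xx k.+1) (xx k))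
   + dot (Ax (xx k.+1) - Ax (xx k)) (Ax (xx k.+1) - Ax (xx k))))) => [k|].
  by rewrite subr0 -!img_Ax -img_sub; exact: hC.
rewrite -(mulr0 C); apply: cvgM; first exact: cvg_cst.
rewrite -(addr0 0); apply: cvgD; first exact: xf_increment_cvg0.
by rewrite -(dot0l (0 : 'cV[R]_(nrow P))); apply: cvg_dot; exact: Ax_increment_cvg0.
Qed.

Lemma yblock_increment_cvg0 j :
  (fun k => ymat j *m (yy k.+1 j - yy k j)) @ \oo --> (0 : 'cV[R]_(nrow P)).
Proof.
have [C C0 hC] := block_coercive (@ymat R P) beta0 sy sy'.
apply: (@cvg_of_dot_le _ _ _ _ _ _ _ (fun k => C * (yf (bsub (yy k.+1) (yy k))
   + dot (a k) (a k)))) => [k|].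
  by rewrite subr0 -!img_By -img_sub; exact: hC.
rewrite -(mulr0 C); apply: cvgM; first exact: cvg_cst.
rewrite -(addr0 0); apply: cvgD; first exact: yf_increment_cvg0.
by rewrite -(dot0l (0 : 'cV[R]_(nrow P))); apply: cvg_dot; exact: By_increment_cvg0.
Qed.

Lemma dist_coercive : exists2 C, 0 <= C &
  forall ws k, residual (wx ws) (wy ws) = 0 ->
  [/\ forall i l, (xx k i - wx ws i) l 0 ^+ 2 <= C * (dist ws k + dot (r k) (r k)),
      forall j l, (yy k j - wy ws j) l 0 ^+ 2 <= C * (dist ws k + dot (r k) (r k))
    & forall l, (ll k - wlam ws) l 0 ^+ 2 <= C * (dist ws k + dot (r k) (r k))].
Proof.
have [_ _ [rx ry] _ _] := hP.
have [Cx Cx0 hx] := block_entry_coercive beta0 sx sx' rx.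
have [Cy Cy0 hy] := block_entry_coercive beta0 sy sy' ry.
have [Cp Cp0 hp] := @potential_coercive R (nrow P) beta tau s beta0 ts0 tau1.
(* With [N] the distance plus squared residual, the x-part is at most $N+2(N+C_pN)$, the y-part
   $N+C_pN$ and the multiplier part $C_pN$. *)
exists (Cx * (3 + 2 * Cp) + Cy * (1 + Cp) + Cp) => [|ws k r0].
  by rewrite !addr_ge0 // mulr_ge0 // addr_ge0 // mulr_ge0.
have [hb hl] := hp (By (yy k) - By (wy ws)) (ll k - wlam ws).
have dE : dist ws k = potential beta tau s (By (yy k) - By (wy ws)) (ll k - wlam ws)
  + xf (bsub (xx k) (wx ws)) + yf (bsub (yy k) (wy ws)) by [].
have p0 := potential_ge0 beta0 ts0 (By (yy k) - By (wy ws)) (ll k - wlam ws) tau1.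
have ex0 := xf_ge0 (bsub (xx k) (wx ws)).
have ey0 := yf_ge0 (bsub (yy k) (wy ws)).
have rr0 := dot_ge0 (r k).
have AE : Ax (xx k) - Ax (wx ws) = r k + - (By (yy k) - By (wy ws)).
  rewrite -[LHS]addr0 -r0 /residual.
  move: (Ax _) (Ax _) (By _) (By _) => ? ? ? ?.
  by apply/matrixP => i j; rewrite !mxE; ring.
have hA := dotDD_le (r k) (- (By (yy k) - By (wy ws))).
rewrite -AE (dotNl, dotNr) dotNr opprK in hA.
set N := dist ws k + _; set bb := dot (By _ - _) _ in hb hA.
set p := potential _ _ _ _ _ in hb hl dE p0.
have [pN xN yN rN] : [/\ p <= N, xf (bsub (xx k) (wx ws)) <= N,
    yf (bsub (yy k) (wy ws)) <= N & dot (r k) (r k) <= N].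
  by rewrite /N dE; split; lra.
have N0 : 0 <= N by lra.
have CpN : Cp * p <= Cp * N by rewrite ler_wpM2l.
have CxN : 0 <= Cx * (3 + 2 * Cp) * N.
  by do 2 apply: mulr_ge0 => //; rewrite addr_ge0 // mulr_ge0.
have CyN : 0 <= Cy * (1 + Cp) * N.
  by do 2 apply: mulr_ge0 => //; rewrite addr_ge0.
have CpN0 : 0 <= Cp * N by rewrite mulr_ge0.
split=> [i l | j l | l].
- apply: le_trans (hx (bsub (xx k) (wx ws)) i l) _; rewrite -/(xf _) img_sub !img_Ax.
  apply: (@le_trans _ _ (Cx * ((3 + 2 * Cp) * N))); last by lra.
  by rewrite ler_wpM2l //; clearbody N; move: pN hA hb; lra.
- apply: le_trans (hy (bsub (yy k) (wy ws)) j l) _; rewrite -/(yf _) img_sub !img_By.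
  apply: (@le_trans _ _ (Cy * ((1 + Cp) * N))); last by lra.
  by rewrite ler_wpM2l // -/bb; clearbody N; move: pN hb; lra.
- by apply: le_trans (entry_le_dot _ l) _; lra.
Qed.

End Core.

(** * Convergence when tau < 1 *)

Section CoreConvergence.
Context (R : realType) (P : problem R).
Hypothesis hP : standing_assumptions P.
Variables (beta sigma1 sigma2 tau s : R) (w : nat -> wspace P).
Hypotheses (beta0 : 0 < beta) (ts0 : 0 < tau + s) (tau1 : tau < 1)
  (region : 0 < - tau ^+ 2 - s ^+ 2 - tau * s + tau + s + 1)
  (sx : (xnum P)%:R - 1 <= sigma1) (sy : (ynum P)%:R - 1 <= sigma2)
  (sx' : xnum P = 1%N \/ (xnum P)%:R - 1 < sigma1)
  (sy' : ynum P = 1%N \/ (ynum P)%:R - 1 < sigma2)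
  (hw : gs_admm beta sigma1 sigma2 tau s w).

Local Notation xx k := (wx (w k)).
Local Notation yy k := (wy (w k)).
Local Notation ll k := (wlam (w k)).
Local Notation r k := (residual (wx (w k)) (wy (w k))).
Local Notation a k := (By (wy (w k.+1)) - By (wy (w k))).
Local Notation distw := (dist beta sigma1 sigma2 tau s w).
Local Notation lyapw := (lyap beta sigma1 sigma2 tau s w).

Let taup : 0 < 1 + tau.
Proof. by have := stepsize_gt ts0 region; lra. Qed.

Let residual0 := residual_cvg0 hP beta0 ts0 tau1 region sx sy hw.

Let residualS0 : (fun k => r k.+1) @ \oo --> (0 : 'cV[R]_(nrow P)).
Proof. by rewrite (cvg_shiftS (fun k => r k)). Qed.

Let dot_residualS0 : (fun k => dot (r k.+1) (r k.+1)) @ \oo --> (0 : R).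
Proof. by rewrite -(dot0l (0 : 'cV[R]_(nrow P))); exact: cvg_dot. Qed.

Let increment0 := By_increment_cvg0 hP beta0 ts0 tau1 region sx sy hw.

Let lyap_nonincreasing ws : Mstar ws -> forall k, lyapw ws k.+1 <= lyapw ws k.
Proof.
move=> hs k; apply: le_trans (lyap_decrease hP beta0 ts0 tau1 region sy hw k hs) _.
by rewrite gerBl lyap_drop_ge0.
Qed.

Let dist_lyap ws k : distw ws k.+1 <= (1 + tau)^-1 * lyapw ws k.
Proof.
rewrite -(ler_pM2l taup) mulrA divff ?gt_eqF // mul1r.
exact: dist_le_lyap.
Qed.

Lemma iterates_bounded ws : Mstar ws -> exists K : R, \oo [set k |
  [/\ forall i l, (xx k.+1 i - wx ws i) l 0 ^+ 2 <= K,
      forall j l, (yy k.+1 j - wy ws j) l 0 ^+ 2 <= K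
    & forall l, (ll k.+1 - wlam ws) l 0 ^+ 2 <= K]].
Proof.
move=> hs; have r0 := Mstar_residual hs.
have [C C0 hC] := dist_coercive hP w beta0 ts0 tau1 sx sy sx' sy'.
(* The initial Lyapunov value bounds all later distances; the 1 bounds the squared residual
   eventually. *)
exists (C * ((1 + tau)^-1 * lyapw ws 0%N + 1)).
have r1 : \oo [set k | dot (r k.+1) (r k.+1) < 1].
  exact: (cvgr_lt 0 dot_residualS0 1 ltr01).
apply: filterS r1 => k /= rk.
have Kk : C * (distw ws k.+1 + dot (r k.+1) (r k.+1)) <=
          C * ((1 + tau)^-1 * lyapw ws 0%N + 1).
  rewrite ler_wpM2l // lerD ?(ltW rk) //; apply: le_trans (dist_lyap ws k) _.
  rewrite ler_wpM2l ?invr_ge0 ?(ltW taup) //.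
  by have /nonincreasing_seqP := lyap_nonincreasing hs; apply.
have [hx hy hl] := hC ws k.+1 r0.
split=> [i l | j l | l].
- exact: le_trans (hx i l) Kk.
- exact: le_trans (hy j l) Kk.
- exact: le_trans (hl l) Kk.
Qed.

Let cvg_shift_back (U : set_system nat) (n : nat) (u : nat -> 'cV[R]_n) z :
  ProperFilter U -> (exists c : 'cV[R]_n, (fun k => u k - z) @ U --> c) ->
  exists c : 'cV[R]_n, u @ U --> c.
Proof.
move=> UU [c uc]; exists (c + z).
rewrite (_ : u = fun k => (u k - z) + z); last first.
  by apply: functional_extensionality_dep => k; rewrite subrK.
by apply: cvgD; [exact: uc | exact: cvg_cst].
Qed.

Lemma iterates_ultra_cvg (U : set_system nat) : UltraFilter U -> \oo `<=` U ->
  exists ws : wspace P,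
  [/\ forall i, (fun k => xx k.+1 i) @ U --> wx ws i,
      forall j, (fun k => yy k.+1 j) @ U --> wy ws j
    & (fun k => ll k.+1) @ U --> wlam ws].
Proof.
move=> UU ooU; have [_ _ _ _ [_ [w0 hs]]] := hP.
have [K hK] := iterates_bounded hs; have {}hK := ooU _ hK.
have hx i : exists z : 'cV[R]_(xdim i), (fun k => xx k.+1 i) @ U --> z.
  apply: (@cvg_shift_back _ _ _ (wx w0 i)); apply: (@ultra_bounded_col_cvg _ _ _ _ _ K).
  by apply: filterS hK => k [h _ _]; exact: h.
have hy j : exists z : 'cV[R]_(ydim j), (fun k => yy k.+1 j) @ U --> z.
  apply: (@cvg_shift_back _ _ _ (wy w0 j)); apply: (@ultra_bounded_col_cvg _ _ _ _ _ K).
  by apply: filterS hK => k [_ h _]; exact: h.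
have [zl hl] : exists z : 'cV[R]_(nrow P), (fun k => ll k.+1) @ U --> z.
  apply: (@cvg_shift_back _ _ _ (wlam w0)); apply: (@ultra_bounded_col_cvg _ _ _ _ _ K).
  by apply: filterS hK => k [_ _ h]; exact: h.
exists ((fun i => projT1 (cid (hx i)), fun j => projT1 (cid (hy j))), zl).
by split=> [i | j |]; [exact: projT2 (cid (hx i)) | exact: projT2 (cid (hy j)) | exact: hl].
Qed.

Let cvg_scale0 (U : set_system nat) n (c : R) (u : nat -> 'cV[R]_n) :
  ProperFilter U -> u @ U --> (0 : 'cV[R]_n) ->
  (fun k => c *: u k) @ U --> (0 : 'cV[R]_n).
Proof.
by move=> UU u0; rewrite -(scaler0 _ c); apply: cvgZ; [exact: cvg_cst | exact: u0].
Qed.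

Lemma ultra_limit_Mstar (U : set_system nat) ws : UltraFilter U -> \oo `<=` U ->
  (forall i, (fun k => xx k.+1 i) @ U --> wx ws i) ->
  (forall j, (fun k => yy k.+1 j) @ U --> wy ws j) ->
  (fun k => ll k.+1) @ U --> wlam ws -> Mstar ws.
Proof.
move=> UU ooU hx hy hl.
have toU n (u : nat -> 'cV[R]_n) (z : 'cV[R]_n) : u @ \oo --> z -> u @ U --> z.
  by move=> uz B /uz; exact: ooU.
have rU := toU _ _ _ residual0.
have rSU := toU _ _ _ residualS0.
have aU := toU _ _ _ increment0.
have [_ [cfx cfy] _ [cX cY] _] := hP.
have rhU : (fun k => r k.+1 - a k) @ U --> (0 : 'cV[R]_(nrow P)).
  by rewrite -(subr0 0); exact: cvgB.
(* The x-condition involves the old multiplier, while the limit is known for the new one; they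
   differ by vanishing terms. *)
have llE k : ll k = ll k.+1 + ((tau * beta) *: (r k.+1 - a k) + (s * beta) *: r k.+1).
  rewrite (iterate_lam hw k).
  move: (r _) (By _) (By _) => ? ? ?.
  by apply/matrixP => i j; rewrite !mxE; ring.
apply: Mstar_intro.
- have rc : (fun k => r k.+1) @ U --> residual (wx ws) (wy ws).
    apply: cvgB; last exact: cvg_cst.
    by apply: cvgD; apply: cvg_img.
  exact: (cvg_unique _ rc rSU).
- apply: (@block_vi_limit _ _ U _ _ _ _ _ _ beta sigma1 (fun k => ll k - beta *: r k)
    (fun k => xx k) (fun k => xx k.+1)) => //.
  + by move=> i; have [] := cfx i.
  + by move=> i; have [] := cX i.
  + by move=> k; exact: (iterate_vi_x hP hw k).
  + rewrite -[wlam ws]subr0; apply: cvgB; last exact: cvg_scale0.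
    under eq_fun do rewrite llE.
    rewrite -[wlam ws]addr0; apply: cvgD; first exact: hl.
    by rewrite -(addr0 0); apply: cvgD; exact: cvg_scale0.
  + move=> i; apply: toU.
    exact: (xblock_increment_cvg0 hP beta0 ts0 tau1 region sx sy sx' hw).
- apply: (@block_vi_limit _ _ U _ _ _ _ _ _ beta sigma2
    (fun k => ll k.+1 + (s * beta) *: r k.+1 - beta *: (r k.+1 - a k))
    (fun k => yy k) (fun k => yy k.+1)) => //.
  + by move=> i; have [] := cfy i.
  + by move=> i; have [] := cY i.
  + by move=> k; exact: (iterate_vi_y hP hw k).
  + rewrite -[wlam ws]subr0; apply: cvgB; last exact: cvg_scale0.
    by rewrite -[wlam ws]addr0; apply: cvgD; [exact: hl | exact: cvg_scale0].
  + move=> j; apply: toU.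
    exact: (yblock_increment_cvg0 hP beta0 ts0 tau1 region sx sy sy' hw).
Qed.

(** The distance to the limit vanishes by continuity along [U]; the residual and increment terms
    vanish along the whole sequence. *)
Lemma ultra_limit_lyap (U : set_system nat) ws : UltraFilter U -> \oo `<=` U ->
  (forall i, (fun k => xx k.+1 i) @ U --> wx ws i) ->
  (forall j, (fun k => yy k.+1 j) @ U --> wy ws j) ->
  (fun k => ll k.+1) @ U --> wlam ws -> lyapw ws @ U --> (0 : R).
Proof.
move=> UU ooU hx hy hl.
have toU (u : nat -> R) (z : R) : u @ \oo --> z -> u @ U --> z.
  by move=> uz B /uz; exact: ooU.
have sub0 n (u : nat -> 'cV[R]_n) (z : 'cV[R]_n) : u @ U --> z ->
    (fun k => u k - z) @ U --> (0 : 'cV[R]_n).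
  by move=> uz; rewrite -(subrr z); apply: cvgB; [exact: uz | exact: cvg_cst].
have Mc (c : R) u : u @ U --> (0 : R) -> (fun k => c * u k) @ U --> (0 : R).
  by move=> u0; rewrite -(mulr0 c); apply: cvgM; [exact: cvg_cst | exact: u0].
have Dc (u v : nat -> R) : u @ U --> (0 : R) -> v @ U --> (0 : R) ->
    (fun k => u k + v k) @ U --> (0 : R).
  by move=> u0 v0; rewrite -(addr0 0); exact: cvgD.
have dotc n (u : nat -> 'cV[R]_n) : u @ U --> (0 : 'cV[R]_n) ->
    (fun k => dot (u k) (u k)) @ U --> (0 : R).
  by move=> u0; rewrite -(dot0l (0 : 'cV[R]_n)); exact: cvg_dot.
have formc n p (m : 'I_p -> nat) (A : forall i, 'M[R]_(n, m i)) sg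
    (u : nat -> forall i, 'cV[R]_(m i)) (z : forall i, 'cV[R]_(m i)) :
    (forall i, (fun k => u k i) @ U --> z i) ->
    (fun k => prox_form A beta sg (bsub (u k) z) (bsub (u k) z)) @ U --> (0 : R).
  move=> uz; rewrite -(@prox_form_bsubv R n p m A beta sg z (bsub z z)).
  by apply: cvg_prox_form => i; rewrite /bsub subrr; exact: sub0.
have bU : (fun k => By (yy k.+1) - By (wy ws)) @ U --> (0 : 'cV[R]_(nrow P)).
  by apply: sub0; exact: cvg_img.
rewrite /lyap; apply: (Dc); first apply: (Dc).
- apply: (Mc); rewrite /dist; apply: (Dc); last exact: formc.
  apply: (Dc); last exact: formc.
  apply: (Dc); apply: (Mc); apply: (dotc) => //.
  by rewrite -(subr0 0); apply: cvgB; [exact: sub0 | exact: cvg_scale0].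
- exact/Mc/toU.
- apply: (Mc); apply: toU.
  exact: (yf_increment_cvg0 hP beta0 ts0 tau1 region sx sy hw).
Qed.

Theorem iterates_cvg : exists2 ws : wspace P, Mstar ws &
  [/\ forall i, (fun k => xx k i) @ \oo --> wx ws i,
      forall j, (fun k => yy k j) @ \oo --> wy ws j
    & (fun k => ll k) @ \oo --> wlam ws].
Proof.
have [U [UU ooU]] := @ultraFilterLemma nat \oo _.
have [ws [hx hy hl]] := iterates_ultra_cvg UU ooU.
have hs := ultra_limit_Mstar UU ooU hx hy hl.
have lU := ultra_limit_lyap UU ooU hx hy hl.
have l0 : lyapw ws @ \oo --> (0 : R).
  apply: (nonincreasing_cvg0_finer _ _ _ lU) => k; last exact: lyap_nonincreasing.
  exact: lyap_ge0.
have [C C0 hC] := dist_coercive hP w beta0 ts0 tau1 sx sy sx' sy'.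
(* A single null sequence dominating the squared errors of all entries at iterate [k.+1]. *)
pose d k := C * ((1 + tau)^-1 * lyapw ws k + dot (r k.+1) (r k.+1)).
have d0 : d @ \oo --> (0 : R).
  rewrite -(mulr0 C); apply: cvgM; first exact: cvg_cst.
  rewrite -(addr0 0); apply: cvgD; last exact: dot_residualS0.
  by rewrite -(mulr0 (1 + tau)^-1); apply: cvgM; [exact: cvg_cst | exact: l0].
have dk k : C * (distw ws k.+1 + dot (r k.+1) (r k.+1)) <= d k.
  by rewrite ler_wpM2l // lerD2r.
have r0 := Mstar_residual hs.
have conv n (u : nat -> 'cV[R]_n) (z : 'cV[R]_n) :
    (forall k l, (u k.+1 - z) l 0 ^+ 2 <= d k) -> u @ \oo --> z.
  move=> hu; rewrite -(cvg_shiftS u); apply: cvg_col => l; apply/subr_cvg0.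
  by apply: cvg0_of_sqr_le d0 => k; have := hu k l; rewrite !mxE.
exists ws => //; split=> [i | j |]; apply: (conv) => k l; apply: le_trans (dk k);
  by have [hcx hcy hcl] := hC ws k.+1 r0.
Qed.

End CoreConvergence.

(** * Exchanging the two groups of blocks *)

Section Swap.
Context (R : realType) (P : problem R).

Definition swap_problem : problem R :=
  @Problem R (nrow P) (ynum P) (xnum P) (@ydim R P) (@xdim R P)
    (@yobj R P) (@xobj R P) (@ymat R P) (@xmat R P) (rhs P)
    (@yset R P) (@xset R P).

Local Notation P' := swap_problem.

Definition swap_point (w : wspace P) : wspace P' := ((wy w, wx w), wlam w).

Lemma residual_swap (x : xspace P) (y : yspace P) :
  residual (y : xspace P') (x : yspace P') = residual x y :> 'cV_(nrow P).
Proof. by rewrite /residual (addrC (Ax x)). Qed.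

Lemma objective_swap (x : xspace P) (y : yspace P) :
  objective (y : xspace P') (x : yspace P') = objective x y.
Proof. by rewrite /objective addrC. Qed.

Lemma auglag_swap beta (x : xspace P) (y : yspace P) (lam : 'cV[R]_(nrow P)) :
  auglag beta (y : xspace P') (x : yspace P') (lam : 'cV[R]_(nrow P')) =
  auglag beta x y lam.
Proof. by rewrite /auglag residual_swap objective_swap. Qed.

Lemma Mstar_swap (w : wspace P) : Mstar (swap_point w) <-> Mstar w.
Proof.
have E (v : wspace P) : dotB (swap_point v) (swap_point w) (J (swap_point w)) =
    dotB v w (J w).
  rewrite !dotB_J /= residual_swap.
  by rewrite (addrC (Ax (wy v : xspace P'))) (addrC (Ax (wy w : xspace P'))).
split=> -[[M1 M2] h]; split; try by split.
  move=> v [Xv Yv]; have := h (swap_point v) (conj Yv Xv).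
  by rewrite E /= !objective_swap.
move=> v [Xv Yv]; have := h ((wy v, wx v), wlam v) (conj Yv Xv).
by rewrite -E /= -!objective_swap.
Qed.

Lemma standing_assumptions_swap :
  standing_assumptions P -> standing_assumptions P'.
Proof.
move=> [[p0 q0] [fx fy] [rx ry] [Sx Sy] [[u hu] [w hw]]].
split=> //; split; last by exists (swap_point w); apply/Mstar_swap.
exists (u.2, u.1); have [[u1 u2 u3] hmin] := hu; split.
  by split=> //=; rewrite residual_swap.
move=> v [v1 v2 v3] /=; rewrite !objective_swap.
apply: (hmin (v.2, v.1)); split=> //=.
by rewrite -residual_swap.
Qed.

(* Cutting the cycle x, lambda, y, lambda one half-step later gives the cycle
   y, lambda, x, lambda: the iteration for the swapped problem. *)
Lemma gs_admm_swap beta sigma1 sigma2 tau s (w : nat -> wspace P) :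
  gs_admm beta sigma1 sigma2 tau s w ->
  gs_admm beta sigma2 sigma1 s tau (fun k =>
    ((wy (w k), wx (w k.+1)), half_dual beta tau (w k) (w k.+1)) : wspace P').
Proof.
move=> hw; have [_ hstep] := hw.
split; first by split; [exact: (iterate_Y hw) | exact: (iterate_X hw)].
move=> k; have [_ hy hl] := hstep k; have [hx _ _] := hstep k.+1.
(* The half-step multiplier of the swapped iteration is the full-step multiplier of the original
   one. *)
have lamE : half_dual beta s
    (((wy (w k), wx (w k.+1)), half_dual beta tau (w k) (w k.+1)) : wspace P')
    (((wy (w k.+1), wx (w k.+2)), half_dual beta tau (w k.+1) (w k.+2)) : wspace P') =
    wlam (w k.+1).
  by rewrite hl {1}/half_dual /= residual_swap.
split=> [j | i |].
- have [Sy my] := hy j; split=> // z Sz.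
  by have := my z Sz; rewrite !auglag_swap.
- have [Sx mx] := hx i; split=> // z Sz.
  by have := mx z Sz; rewrite lamE !auglag_swap.
- by rewrite lamE /= residual_swap.
Qed.

End Swap.

(** * Choice of the cut and derivation of the stated limits *)

Section Conclusion.
Context (R : realType) (P : problem R).
Hypothesis hP : standing_assumptions P.
Variables (beta sigma1 sigma2 tau s : R) (w : nat -> wspace P).
Hypotheses (beta0 : 0 < beta) (region : stepsize_region (tau, s))
  (sx : (xnum P)%:R - 1 <= sigma1) (sy : (ynum P)%:R - 1 <= sigma2)
  (sx' : xnum P = 1%N \/ (xnum P)%:R - 1 < sigma1)
  (sy' : ynum P = 1%N \/ (ynum P)%:R - 1 < sigma2)
  (hw : gs_admm beta sigma1 sigma2 tau s w).

(** For $\tau=1+a$ and $s=1+b$ the polynomial is $-2a-2b-a^2-b^2-ab$, not positive when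
    $a,b\ge0$. *)
Lemma stepsize_lt1 : tau < 1 \/ s < 1.
Proof.
have [/= h1 h2] := region; have [|t1] := ltP tau 1; first by left.
right; rewrite ltNge; apply/negP => s1.
have : 0 <= (tau - 1) * (s - 1) by rewrite mulr_ge0 // subr_ge0.
by have := sqr_ge0 (tau - 1); have := sqr_ge0 (s - 1); nra.
Qed.

Lemma gs_admm_cvg : exists2 ws : wspace P, Mstar ws &
  [/\ forall i, (fun k => wx (w k) i) @ \oo --> wx ws i,
      forall j, (fun k => wy (w k) j) @ \oo --> wy ws j
    & (fun k => wlam (w k)) @ \oo --> wlam ws].
Proof.
have [/= ts0 reg] := region.
have [t1|s1] := stepsize_lt1; first exact: (iterates_cvg hP beta0 ts0 t1 reg sx sy sx' sy' hw).
have st0 : 0 < s + tau by rewrite addrC.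
have reg' : 0 < - s ^+ 2 - tau ^+ 2 - s * tau + s + tau + 1 by lra.
have [ws hs [hy hx hl]] := iterates_cvg (standing_assumptions_swap hP) beta0 st0 s1 reg'
  sy sx sy' sx' (gs_admm_swap hw).
exists ((wy ws, wx ws), wlam ws); first exact/Mstar_swap.
have cx i : (fun k => wx (w k) i) @ \oo --> (wy ws i : 'cV[R]_(xdim i)).
  by rewrite -(cvg_shiftS (fun k => wx (w k) i)); exact: hx.
have cy j : (fun k => wy (w k) j) @ \oo --> (wx ws j : 'cV[R]_(ydim j)).
  exact: hy.
split=> //=.
rewrite -(cvg_shiftS (fun k => wlam (w k))).
have [_ hstep] := hw.
(* The swapped iteration gives the limit of the half-step multipliers only; the full step adds a
   multiple of the residual, which vanishes at the limit. *)
have -> : [sequence wlam (w n.+1)]_n = fun k => half_dual beta tau (w k) (w k.+1)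
    - (s * beta) *: residual (wx (w k.+1)) (wy (w k.+1)).
  by apply: functional_extensionality_dep => k; have [] := hstep k.
rewrite -[wlam ws]subr0 -(scaler0 _ (s * beta)).
apply: cvgB; first exact: hl.
apply: cvgZ; first exact: cvg_cst.
have r0 : residual (wy ws : xspace P) (wx ws : yspace P) = 0.
  by rewrite -residual_swap; exact: (Mstar_residual hs).
rewrite -r0 (cvg_shiftS (fun k => residual (wx (w k)) (wy (w k)))).
apply: cvgB; last exact: cvg_cst.
by apply: cvgD; apply: cvg_img.
Qed.

(** Convergence of the whole sequence to a point of $\mathcal{M}^*$ yields each limit by continuity,
    as the residual of that point is 0. *)
Lemma gs_admm_conclusion :
  [/\ (fun k => \sum_i enorm (xmat i *m (wx (w k) i - wx (w k.+1) i)) ^+ 2)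
        @ \oo --> (0 : R),
      (fun k => \sum_j enorm (ymat j *m (wy (w k) j - wy (w k.+1) j)) ^+ 2)
        @ \oo --> (0 : R),
      (fun k => enorm (residual (wx (w k)) (wy (w k)))) @ \oo --> (0 : R)
    & exists2 winf : wspace P, Mstar winf & wtilde beta w @ \oo --> winf].
Proof.
have [ws hs [hx hy hl]] := gs_admm_cvg.
have hxS i : (fun k => wx (w k.+1) i) @ \oo --> wx ws i.
  by rewrite (cvg_shiftS (fun k => wx (w k) i)); exact: hx.
have hyS j : (fun k => wy (w k.+1) j) @ \oo --> wy ws j.
  by rewrite (cvg_shiftS (fun k => wy (w k) j)); exact: hy.
have r0 := Mstar_residual hs.
have enorm0 n (u : nat -> 'cV[R]_n) : u @ \oo --> (0 : 'cV[R]_n) ->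
    (fun k => enorm (u k)) @ \oo --> (0 : R).
  move=> u0; apply: (@cvg0_of_sqr_le _ _ _ _ _ (fun k => dot (u k) (u k))) => [k|].
    by rewrite sqr_enorm.
  by rewrite -(dot0l (0 : 'cV[R]_n)); exact: cvg_dot.
have block0 n m (A : 'M[R]_(n, m)) (u v : nat -> 'cV[R]_m) (z : 'cV[R]_m) :
    u @ \oo --> z -> v @ \oo --> z ->
    (fun k => enorm (A *m (u k - v k)) ^+ 2) @ \oo --> (0 : R).
  move=> uz vz; under eq_fun do rewrite expr2.
  have h : (fun k => enorm (A *m (u k - v k))) @ \oo --> (0 : R).
    apply: enorm0; rewrite -(mulmx0 _ A); apply: cvg_mulmx.
    by rewrite -(subrr z); exact: cvgB.
  by rewrite -(mulr0 0); exact: (cvgM h h).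
have sum0 n (f : 'I_n -> nat -> R) : (forall i, f i @ \oo --> (0 : R)) ->
    (fun k => \sum_i f i k) @ \oo --> (0 : R).
  move=> f0; have E : \sum_(i < n) (0 : R) = 0 by rewrite big1.
  by have := cvg_sum_fin _ f0; rewrite E; apply.
split.
- by apply: sum0 => i; exact: (block0 _ _ _ _ _ _ (hx i) (hxS i)).
- by apply: sum0 => j; exact: (block0 _ _ _ _ _ _ (hy j) (hyS j)).
- apply: enorm0; rewrite -r0; apply: cvgB; last exact: cvg_cst.
  by apply: cvgD; apply: cvg_img.
- exists ws => //.
  have cx : (fun k => wx (w k.+1)) @ \oo --> wx ws by exact: cvg_blocks.
  have cy : (fun k => wy (w k.+1)) @ \oo --> wy ws by exact: cvg_blocks.
  have cl : (fun k => wlam (w k)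
      - beta *: residual (wx (w k.+1)) (wy (w k))) @ \oo --> wlam ws.
    rewrite -[wlam ws]subr0 -(scaler0 _ beta); apply: cvgB; first exact: hl.
    apply: cvgZ; first exact: cvg_cst.
    rewrite -r0; apply: cvgB; last exact: cvg_cst.
    by apply: cvgD; apply: cvg_img.
  have -> : ws = ((wx ws, wy ws), wlam ws) by case: (ws) => -[].
  exact: (cvg_pair (cvg_pair cx cy) cl).
Qed.

End Conclusion.

Theorem mainTheorem6 (R : realType) (P : problem R)
    (hP : standing_assumptions P) (beta : R) (hbeta : 0 < beta) :
  (ynum P = 1%N ->
   forall sigma1 tau s : R,
     (xnum P)%:R - 1 < sigma1 -> stepsize_region (tau, s) ->
   forall w : nat -> wspace P, gs_admm beta sigma1 0 tau s w ->
   [/\ (fun k => \sum_i enorm (xmat i *m (wx (w k) i - wx (w k.+1) i)) ^+ 2)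
         @ \oo --> (0 : R),
       (fun k => enorm (residual (wx (w k)) (wy (w k)))) @ \oo --> (0 : R)
     & exists2 winf : wspace P, Mstar winf & wtilde beta w @ \oo --> winf])
  /\
  (xnum P = 1%N ->
   forall sigma2 tau s : R,
     (ynum P)%:R - 1 < sigma2 -> stepsize_region (tau, s) ->
   forall w : nat -> wspace P, gs_admm beta 0 sigma2 tau s w ->
   [/\ (fun k => \sum_j enorm (ymat j *m (wy (w k) j - wy (w k.+1) j)) ^+ 2)
         @ \oo --> (0 : R),
       (fun k => enorm (residual (wx (w k)) (wy (w k)))) @ \oo --> (0 : R)
     & exists2 winf : wspace P, Mstar winf & wtilde beta w @ \oo --> winf]).
Proof.
split=> n1 sigma tau s hs hr w hw.
- have sy : (ynum P)%:R - 1 <= 0 :> R by rewrite n1 subrr.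
  by have [] := gs_admm_conclusion hP hbeta hr (ltW hs) sy (or_intror hs) (or_introl n1) hw.
- have sx : (xnum P)%:R - 1 <= 0 :> R by rewrite n1 subrr.
  by have [] := gs_admm_conclusion hP hbeta hr sx (ltW hs) (or_introl n1) (or_intror hs) hw.
Qed.
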